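(* Let $S$ be an unambiguous semigroup (possibly infinite), fix a choice of representatives $r_s,\ell_s$ as described in the context, and consider the string rewrite system consisting of the rules (1.1)–(1.6), (2.1)–(2.4) listed in the context, acting on nonempty strings over the alphabet $A=S\cup\overline{S-\{0\}}\cup\{0\}$. Then this rewrite system is complete, i.e. it is terminating (there is no infinite sequence of rewrite steps) and confluent. Moreover, its normal forms (the nonempty strings to which no rule applies) are exactly the string $(0)$ and the strings of one of the two shapes $$([r_1,]\ \overline{\ell_2},\ \ldots,\ r_{n-1},\ \overline{\ell_n},\ s,\ \overline{r'_m},\ \ell'_{m-1},\ \ldots,\ \overline{r'_2}\ [,\ell'_1])$$ with $[r_1>_{\mathcal L}]\ \ell_2>_{\mathcal R}\cdots>_{\mathcal R}r_{n-1}>_{\mathcal L}\ell_n>_{\mathcal R}s\leq_{\mathcal L}r'_m<_{\mathcal R}\ell'_{m-1}<_{\mathcal L}\cdots<_{\mathcal L}r'_2\ [<_{\mathcal R}\ell'_1]$, or $$([r_1,]\ \overline{\ell_2},\ \ldots,\ r_{n-2},\ \overline{\ell_{n-1}},\ r_n,\ \overline{s},\ \ell'_m,\ \overline{r'_{m-1}},\ \ell'_{m-2},\ \ldots,\ \overline{r'_2}\ [,\ell'_1])$$ with $[r_1>_{\mathcal L}]\ \ell_2>_{\mathcal R}\cdots>_{\mathcal R}r_{n-2}>_{\mathcal L}\ell_{n-1}>_{\mathcal R}r_n>_{\mathcal L}s\leq_{\mathcal R}\ell'_m<_{\mathcal L}r'_{m-1}<_{\mathcal R}\ell'_{m-2}<_{\mathcal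 L}\cdots<_{\mathcal L}r'_2\ [<_{\mathcal R}\ell'_1]$, where $s\in S-\{0\}$ is arbitrary, every $r_i,r'_j$ is a chosen representative of an $\mathcal R$-class, every $\ell_i,\ell'_j$ is a chosen representative of an $\mathcal L$-class, and elements in square brackets may be absent. Spelled out uniformly, the two shapes mean: the string is $(x_1,\ldots,x_k)$, $k\ge 1$, whose entries are alternately of the form $a_i$ (unbarred) and $\overline{a_i}$ (barred) with $a_i\in S-\{0\}$ (either kind may come first), and there is a position $c$, $1\le c\le k$, with $a_1>a_2>\cdots>a_c\leq a_{c+1}<a_{c+2}<\cdots<a_k$, where the relation between $a_i$ and $a_{i+1}$ is taken in the $\mathcal L$-order if $x_i$ is unbarred and in the $\mathcal R$-order if $x_i$ is barred; for $i<c$, $a_i$ is the chosen representative of its $\mathcal R$-class if $x_i$ is unbarred and of its $\mathcal L$-class if $x_i$ is barred; for $i>c$, $a_i$ is the chosen representative of its $\mathcal R$-class if $x_i$ is barred and of its $\mathcal L$-class if $x_i$ is unbarred; $a_c$ is arbitrary.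
   Context: Let $S$ be a semigroup. $0$ is the zero of $S$ if $S$ has one; otherwise $0$ is a new symbol not in $S$ (and then $S-\{0\}=S$). $S^1$ is $S$ if $S$ is a monoid, and otherwise $S$ with a new identity adjoined. $\leq_{\mathcal L},<_{\mathcal L},\equiv_{\mathcal L}$, $\leq_{\mathcal R},<_{\mathcal R},\equiv_{\mathcal R}$ are Green's preorders, their strict parts and equivalences ($s\leq_{\mathcal L}t$ iff $s\in S^1t$; $s\leq_{\mathcal R}t$ iff $s\in tS^1$), and $\mathcal D,\mathcal H$ are Green's usual relations. ''$\mathcal L$-incomparable'' means neither $s\leq_{\mathcal L}t$ nor $t\leq_{\mathcal L}s$; ''$\mathcal L$-comparable'' is the negation; similarly for $\mathcal R$. $S$ is unambiguous iff for all $s,t,u\in S-\{0\}$: $s>_{\mathcal L}u<_{\mathcal L}t$ implies that $s,t$ are $\mathcal L$-comparable, and $s>_{\mathcal R}u<_{\mathcal R}t$ implies that $s,t$ are $\mathcal R$-comparable. $\overline{S-\{0\}}=\{\overline s:s\in S-\{0\}\}$ is a copy of $S-\{0\}$ disjoint from $S\cup\{0\}$, with $\overline{\overline s}=s$ and the convention $\overline 0=0$. Strings are written as tuples; $st$ denotes the product in $S$ and $(s,t)$ the string of length 2. Representatives: choose one element in every $\mathcal R$-class and one in every $\mathcal L$-class of $S$, so that $\mathcal D$-related representatives of $\mathcal R$-classes are $\mathcal L$-related, $\mathcal D$-related representatives of $\mathcal L$-classes are $\mathcal R$-related, and a representative of an $\mathcal L$-class and a representative of an $\mathcal R$-class lying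 in the same $\mathcal H$-class are equal. $r_s$ (resp. $\ell_s$) is the chosen representative of the $\mathcal R$-class (resp. $\mathcal L$-class) of $s$. Partial functions (arguments in $S-\{0\}$; values do not depend on the choices): - if $u\leq_{\mathcal L}v\geq_{\mathcal R}w$, then $B(u,v,w)=uz$ where $z\in S^1$ satisfies $w=vz$; - if $u\geq_{\mathcal L}v$, then $B_{\mathcal R}(u,v)=x r_u$ where $x\in S^1$ satisfies $v=xu$; - if $v\leq_{\mathcal R}u$, then $B_{\mathcal L}(v,u)=\ell_u y$ where $y\in S^1$ satisfies $v=uy$. Rewrite rules (applied to contiguous substrings): (1.1) $(s,t)\to(st)$ and $(\overline s,\overline t)\to(\overline{ts})$, for $s,t\in S$; (1.2) $(0,0)\to(0)$, $(0,s)\to(0)$, $(s,0)\to(0)$, $(0,\overline s)\to(0)$, $(\overline s,0)\to(0)$, for $s\in S$; (1.3) $(s,\overline t)\to(0)$ if $s,t\in S-\{0\}$ are $\mathcal L$-incomparable; (1.4) $(\overline s,t)\to(0)$ if $s,t\in S-\{0\}$ are $\mathcal R$-incomparable; (1.5) $(u,\overline v,w)\to(B(u,v,w))$ if $u,v,w\in S-\{0\}$ and $u\leq_{\mathcal L}v\geq_{\mathcal R}w$; (1.6) $(\overline u,v,\overline w)\to(\overline{B(w,v,u)})$ if $u,v,w\in S-\{0\}$ and $u\leq_{\mathcal R}v\geq_{\mathcal L}w$; and, for $s,t\in S-\{0\}$: (2.1) $(s,\overline t)\to(r_s,\overline{B_{\mathcal R}(s,t)})$ if $s>_{\mathcal L}t$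 and $s\neq r_s$; (2.2) $(\overline s,t)\to(\overline{\ell_s},B_{\mathcal L}(t,s))$ if $s>_{\mathcal R}t$ and $s\neq\ell_s$; (2.3) $(\overline t,s)\to(\overline{B_{\mathcal L}(t,s)},\ell_s)$ if $t\leq_{\mathcal R}s$ and $s\neq\ell_s$; (2.4) $(t,\overline s)\to(B_{\mathcal R}(s,t),\overline{r_s})$ if $t\leq_{\mathcal L}s$ and $s\neq r_s$. *)

(* Defs.v *)
From mathcomp Require Import all_boot.
From mathcomp Require Import boolp.
From Stdlib Require Import Relation_Operators.

Set Implicit Arguments.
Unset Strict Implicit.
Unset Printing Implicit Defensive.

Local Open Scope group_scope.

Section Rewriting.
Variables (T : Type) (R : T -> T -> Prop).

Definition terminating : Prop :=
  ~ exists f : nat -> T, forall n, R (f n) (f n.+1).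

Definition confluent : Prop :=
  forall x y z, clos_refl_trans T R x y -> clos_refl_trans T R x z ->
  exists w, clos_refl_trans T R y w /\ clos_refl_trans T R z w.

Definition complete : Prop := terminating /\ confluent.

Definition normal_form (x : T) : Prop := ~ exists y, R x y.

End Rewriting.

Section Green.
Variable S : semigroupType.
Implicit Types s t u v w b : S.

Definition is_zero (z : S) : Prop := forall s, z * s = z /\ s * z = z.

Definition has_identity : Prop := exists e, forall s, e * s = s /\ s * e = s.

(* S^1 inside [option S]: [None] is the adjoined identity, which is present
   only when S is not a monoid. *)
Definition S1 (x : option S) : Prop :=
  if x is None then ~ has_identity else True.

(* The products xs and sx in S^1, for s in S. *)
Definition mulS1l (x : option S) s : S := if x is Some a then a * s else s.
Definition mulS1r s (x : option S) : S := if x is Some a then s * a else s.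

Definition leL s t : Prop := exists2 x, S1 x & s = mulS1l x t.
Definition leR s t : Prop := exists2 x, S1 x & s = mulS1r t x.
Definition ltL s t : Prop := leL s t /\ ~ leL t s.
Definition ltR s t : Prop := leR s t /\ ~ leR t s.
Definition eqL s t : Prop := leL s t /\ leL t s.
Definition eqR s t : Prop := leR s t /\ leR t s.
Definition eqH s t : Prop := eqL s t /\ eqR s t.
Definition eqD s t : Prop := exists u, eqL s u /\ eqR u t.

Definition comparableL s t : Prop := leL s t \/ leL t s.
Definition comparableR s t : Prop := leR s t \/ leR t s.

(* S - {0}; this is the whole of S when S has no zero. *)
Definition nonzero : Type := {s : S | ~~ `[< is_zero s >]}.

Definition unambiguous : Prop :=
  forall s t u : nonzero,
    (ltL (val u) (val s) -> ltL (val u) (val t) ->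
       comparableL (val s) (val t)) /\
    (ltR (val u) (val s) -> ltR (val u) (val t) ->
       comparableR (val s) (val t)).

Record representatives (r ell : S -> S) : Prop := Representatives {
  repR_class : forall s, eqR (r s) s;
  repR_unique : forall s t, eqR s t -> r s = r t;
  repL_class : forall s, eqL (ell s) s;
  repL_unique : forall s t, eqL s t -> ell s = ell t;
  repR_D : forall s t, eqD (r s) (r t) -> eqL (r s) (r t);
  repL_D : forall s t, eqD (ell s) (ell t) -> eqR (ell s) (ell t);
  rep_H : forall s t, eqH (ell s) (r t) -> ell s = r t
}.

(* The partial functions B, B_R and B_L are given by their graphs: the last
   argument is the value. *)
Definition graphB u v w b : Prop :=
  [/\ leL u v, leR w v &
      exists z, [/\ S1 z, w = mulS1r v z & b = mulS1r u z]].

Definition graphBR (r : S -> S) u v b : Prop :=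
  leL v u /\ exists x, [/\ S1 x, v = mulS1l x u & b = mulS1l x (r u)].

Definition graphBL (ell : S -> S) v u b : Prop :=
  leR v u /\ exists y, [/\ S1 y, v = mulS1r u y & b = mulS1r (ell u) y].

(* The alphabet, i.e. the union of S, the barred copy of S - {0}, and {0}.
   [Zero] is the letter 0, hence also the zero of S if there is one. *)
Inductive letter : Type :=
| Zero
| Plain of nonzero
| Barred of nonzero.

(* s and its barred version as letters, for arbitrary s in S: both are the
   letter 0 when s is the zero of S. *)
Definition plain s : letter := oapp Plain Zero (insub s).
Definition barred s : letter := oapp Barred Zero (insub s).

Section System.
Variables r ell : S -> S.

Inductive rule : seq letter -> seq letter -> Prop :=
| rule11_plain s t :
    rule [:: plain s; plain t] [:: plain (s * t)]
| rule11_barred s t :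
    rule [:: barred s; barred t] [:: barred (t * s)]
| rule12_00 : rule [:: Zero; Zero] [:: Zero]
| rule12_0s s : rule [:: Zero; plain s] [:: Zero]
| rule12_s0 s : rule [:: plain s; Zero] [:: Zero]
| rule12_0b s : rule [:: Zero; barred s] [:: Zero]
| rule12_b0 s : rule [:: barred s; Zero] [:: Zero]
| rule13 (s t : nonzero) :
    ~ comparableL (val s) (val t) ->
    rule [:: Plain s; Barred t] [:: Zero]
| rule14 (s t : nonzero) :
    ~ comparableR (val s) (val t) ->
    rule [:: Barred s; Plain t] [:: Zero]
| rule15 (u v w : nonzero) b :
    leL (val u) (val v) -> leR (val w) (val v) ->
    graphB (val u) (val v) (val w) b ->
    rule [:: Plain u; Barred v; Plain w] [:: plain b]
| rule16 (u v w : nonzero) b :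
    leR (val u) (val v) -> leL (val w) (val v) ->
    graphB (val w) (val v) (val u) b ->
    rule [:: Barred u; Plain v; Barred w] [:: barred b]
| rule21 (s t : nonzero) b :
    ltL (val t) (val s) -> val s <> r (val s) ->
    graphBR r (val s) (val t) b ->
    rule [:: Plain s; Barred t] [:: plain (r (val s)); barred b]
| rule22 (s t : nonzero) b :
    ltR (val t) (val s) -> val s <> ell (val s) ->
    graphBL ell (val t) (val s) b ->
    rule [:: Barred s; Plain t] [:: barred (ell (val s)); plain b]
| rule23 (s t : nonzero) b :
    leR (val t) (val s) -> val s <> ell (val s) ->
    graphBL ell (val t) (val s) b ->
    rule [:: Barred t; Plain s] [:: barred b; plain (ell (val s))]
| rule24 (s t : nonzero) b :
    leL (val t) (val s) -> val s <> r (val s) ->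
    graphBR r (val s) (val t) b ->
    rule [:: Plain t; Barred s] [:: plain b; barred (r (val s))].

(* No step starts from or reaches the empty string. *)
Definition step (w w' : seq letter) : Prop :=
  exists p q x y, [/\ rule x y, w = p ++ x ++ q & w' = p ++ y ++ q].

(* Positions are numbered from 0 to k - 1. The letter at position i is barred
   iff [bar i]; [bar0] tells whether the first letter is barred. *)
Definition normal_shape (w : seq letter) : Prop :=
  exists (k c : nat) (bar0 : bool) (a : nat -> nonzero),
    let bar i := bar0 (+) odd i in
    let le i s t := if bar i then leR s t else leL s t in
    let lt i s t := if bar i then ltR s t else ltL s t in
    [/\ (c < k)%N,
        w = mkseq (fun i => if bar i then Barred (a i) else Plain (a i)) k,
        [/\ forall i, (i < c)%N -> lt i (val (a i.+1)) (val (a i)),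
            (c.+1 < k)%N -> le c (val (a c)) (val (a c.+1)) &
            forall i, (c < i)%N -> (i.+1 < k)%N ->
              lt i (val (a i)) (val (a i.+1))],
        forall i, (i < c)%N ->
          val (a i) = if bar i then ell (val (a i)) else r (val (a i)) &
        forall i, (c < i)%N -> (i < k)%N ->
          val (a i) = if bar i then r (val (a i)) else ell (val (a i))].

End System.
End Green.

Arguments Zero {S}.

(* Main.v *)
Require Import Defs.
From mathcomp Require Import all_boot.
From mathcomp Require Import boolp.
From Stdlib Require Import Relation_Operators Operators_Properties.

(** The rules are of two kinds: those that shorten a string, and those that keep
    its length and replace the larger of two neighbours (s, bar t), or
    (bar s, t), by the chosen representative of its class. A step of the second
    kind sends (s, bar t) to (sy, bar (ty)), where the factor y has an inverse
    y' in the sense that syy' = s and tyy' = t. So consider strings up to moving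
    such invertible factors along edges ([eqv], [sim]).

    Moving factors preserves the order relations between neighbours, hence the
    redexes of the shortening rules and, up to moved factors, their results
    ([eqv_red]). Modulo this relation the shortening rules are locally confluent
    ([red_local]); unambiguity guarantees that a pair that rewrites to 0 still
    does so after one of its letters has been multiplied into a neighbour. As
    lengths decrease, every string has a unique form without shortening redex up
    to moved factors ([reduced_form_unique]), and this form is invariant under
    all rules.

    A string to which no rule applies descends to a valley and then ascends,
    because an element above both of its neighbours is the middle of a redex
    ([irreducible_shape]). In such a string all elements but the valley are
    representatives, which determines the moved factors: from both ends towards
    the valley, one sees that they act trivially ([shape_unique]). So an
    irreducible string is determined by its invariant, and confluence follows
    from termination.

    For termination, the orientation of every edge (its larger end) is constant
    while the length is. A choice at one edge can spoil only the next edge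
    downhill, so exponential weights that shrink downhill make a decreasing cost
    ([choose_cost]). At a peak the two edges compete for the same element; there
    the compatibility of the representatives of the two kinds of classes shows
    that satisfying one edge does not spoil the other ([rep_rep]). *)

Set Implicit Arguments.
Unset Strict Implicit.
Unset Printing Implicit Defensive.

Section Theory.
Variable S : semigroupType.
Local Notation nz := (nonzero S).

(** * Products and Green's preorders of a semigroup and of its opposite *)

(** Exchanging plain and barred letters turns the system of [S] into that of the
    opposite semigroup. So each notion below depends on the sign [b] of a
    letter, [true] for barred: the product of sign [true] is the reversed one,
    and one argument then serves for both kinds of letters. *)
Definition op (b : bool) (s t : S) : S := if b then (t * s)%g else (s * t)%g.

(** [None] is an identity adjoined to [S] in all cases, so that multipliers in
    S^1 can be composed without case analysis. *)
Definition mul (b : bool) (x y : option S) : option S :=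
  match x, y with
  | Some s, Some t => Some (op b s t)
  | None, _ => y
  | _, None => x
  end.

Local Notation "x *[ b ] y" := (mul b x y)
  (at level 40, left associativity, format "x  *[ b ]  y").

Lemma mulA b x y z : x *[b] (y *[b] z) = x *[b] y *[b] z.
Proof.
by case: x y z => [x|] [y|] [z|] //=; congr Some; case: b; rewrite /= mulgA.
Qed.

Lemma mulx1 b x : x *[b] None = x. Proof. by case: x. Qed.

Lemma cancel_l b g g' s y :
  g' *[b] (g *[b] s) = s -> g' *[b] (g *[b] (s *[b] y)) = s *[b] y.
Proof. by rewrite !mulA => ->. Qed.

Lemma cancel_r1 b h h' s : s *[b] h *[b] h' = s -> s *[b] (h *[b] h') = s.
Proof. by rewrite mulA. Qed.

Lemma cancel_r b h h' s y :
  s *[b] h *[b] h' = s -> s *[b] (h *[b] (h' *[b] y)) = s *[b] y.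
Proof. by rewrite !mulA => ->. Qed.

Lemma mulN b x y : x *[~~ b] y = y *[b] x.
Proof. by case: x y => [x|] [y|] //=; case: b. Qed.

Definition emb (s : nz) : option S := Some (val s).

Lemma emb_inj : injective emb.
Proof. by move=> s t [] /val_inj. Qed.

Lemma nonzeroP (s : nz) : ~ is_zero (val s).
Proof. by move=> /asboolP h; move: (valP s); rewrite h. Qed.

Lemma mul_zero b g z h y :
  is_zero z -> Some y = g *[b] Some z *[b] h -> y = z.
Proof.
move=> zz; have [hl hr] : (forall s, op b z s = z) /\ (forall s, op b s z = z).
  by split=> s; have [] := zz s; case: (b).
by case: g h => [g|] [h|] /= [->]; rewrite ?hr ?hl.
Qed.

(** The order that decides between a letter of sign [b] and its right neighbour
    when that has the other sign. By [leP], [s] is below [t] when it is a left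
    multiple of [t] in the product of sign [b]; by [mulN], it is below [t] in the
    order of sign [~~ b] when it is a right multiple of [t] in that product. *)
Definition le (b : bool) (s t : S) : Prop := if b then leR s t else leL s t.
Definition lt (b : bool) (s t : S) : Prop := if b then ltR s t else ltL s t.

(** It does not matter whether the adjoined identity is new: an identity of [S]
    acts on [S] as the new one does. *)
Lemma S1_witness (P : option S -> Prop) x :
  (forall e, (forall s, e * s = s /\ s * e = s)%g -> P None -> P (Some e)) ->
  P x -> exists2 y, S1 y & P y.
Proof.
move=> Pe; case: x => [a|] Px; first by exists (Some a).
case: (pselect (has_identity S)) => [[e he]|h]; last by exists None.
by exists (Some e) => //; apply: Pe.
Qed.

Lemma leP b s t : le b s t <-> exists x, Some s = x *[b] Some t.
Proof.
split.
  by case: b => -[[a|] _ /= ->];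
    [exists (Some a)|exists None|exists (Some a)|exists None].
case=> x hx; have: if b then s = mulS1r t x else s = mulS1l x t.
  by move: hx; case: b; case: x => [a|] /= [->].
case: b {hx} => hx; apply: (S1_witness _ hx) => e he /= ->; by have [] := he t.
Qed.

Arguments mul : simpl never.
Arguments emb : simpl never.

Lemma ltE b s t : lt b s t <-> le b s t /\ ~ le b t s.
Proof. by case: b. Qed.

Lemma le_trans b t s u : le b s t -> le b t u -> le b s u.
Proof.
move=> /leP[x hx] /leP[y hy]; apply/leP; exists (x *[b] y).
by rewrite -mulA -hy.
Qed.

Definition comparable b s t := le b s t \/ le b t s.

Lemma comparableE b s t :
  comparable b s t <-> if b then comparableR s t else comparableL s t.
Proof. by case: b. Qed.

Lemma unambiguousP b (s t u : nz) : unambiguous S ->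
  le b (val u) (val s) -> le b (val u) (val t) -> comparable b (val s) (val t).
Proof.
move=> unam us ut.
case: (pselect (le b (val s) (val u))) => [su|nsu].
  by left; apply: le_trans su ut.
case: (pselect (le b (val t) (val u))) => [tu|ntu].
  by right; apply: le_trans tu us.
have [hL hR] := unam s t u.
by case: b us ut nsu ntu => us ut nsu ntu; [apply: hR|apply: hL]; split.
Qed.

(** * Strings and the rules that shorten them *)

(** [None] is the letter 0 and [Some (b, s)] is the nonzero letter [s], barred
    iff [b]. *)
Definition word : Type := seq (option (bool * nz)).

Definition letter_of (b : bool) (s : S) : option (bool * nz) :=
  omap (pair b) (insub s).

Variant letter_of_spec b s : option (bool * nz) -> Prop :=
| MkNonzero s' of val s' = s : letter_of_spec b s (Some (b, s'))
| MkZero of is_zero s : letter_of_spec b s None.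

Lemma letter_ofP b s : letter_of_spec b s (letter_of b s).
Proof.
rewrite /letter_of; case: insubP => [u _ <-|] /=; first by constructor.
by rewrite negbK => /asboolP h; constructor.
Qed.

Lemma letter_of_val b (s : nz) : letter_of b (val s) = Some (b, s).
Proof. by rewrite /letter_of valK. Qed.

Lemma letter_of_zero b s : is_zero s -> letter_of b s = None.
Proof. by case: letter_ofP => // s' <- /nonzeroP. Qed.

(** In [red_meet], u = xv and w = vz are the divisibilities that make the value
    B(u, v, w) = uz = xvz = xw symmetric. In the alternating rules the sign [c]
    is a separate index, which keeps case analysis on a derivation free of
    equations between [b] and [~~ b]. *)
Inductive red : word -> word -> Prop :=
| red_mul b s t q :
    red (Some (b, s) :: Some (b, t) :: q) (letter_of b (op b (val s) (val t)) :: q)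
| red_zl x q : red (None :: x :: q) (None :: q)
| red_zr x q : red (x :: None :: q) (None :: q)
| red_inc b c s t q : c = ~~ b -> ~ comparable b (val s) (val t) ->
    red (Some (b, s) :: Some (c, t) :: q) (None :: q)
| red_meet b c u v w x z m q : c = ~~ b ->
    emb u = x *[b] emb v -> emb w = emb v *[b] z ->
    Some m = x *[b] emb v *[b] z ->
    red (Some (b, u) :: Some (c, v) :: Some (b, w) :: q) (letter_of b m :: q)
| red_cons x W W' : red W W' -> red (x :: W) (x :: W').

Variant red_spec b s W : word -> Prop :=
| RedMul t q of W = Some (b, t) :: q :
    red_spec b s W (letter_of b (op b (val s) (val t)) :: q)
| RedInc t q of W = Some (~~ b, t) :: q & ~ comparable b (val s) (val t) :
    red_spec b s W (None :: q)
| RedMeet v w x z m q of W = Some (~~ b, v) :: Some (b, w) :: q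
    & emb s = x *[b] emb v & emb w = emb v *[b] z
    & Some m = x *[b] emb v *[b] z :
    red_spec b s W (letter_of b m :: q)
| RedTail W' of red W W' : red_spec b s W (Some (b, s) :: W').

Definition zero_free (W : word) : bool := all isSome W.

Lemma red_inv b s W V : zero_free W -> red (Some (b, s) :: W) V -> red_spec b s W V.
Proof.
move=> lW; move E : (Some (b, s) :: W) => U r.
case: r E lW => {U V} //.
- by move=> b0 s0 t q [-> -> ->] _; constructor.
- by move=> x q [_ ->].
- by move=> b0 c s0 t q -> nc [-> -> ->] _; apply: RedInc nc.
- move=> b0 c u v w x z m q -> hu hw hm [-> -> ->] _.
  exact: RedMeet hu hw hm.
- by move=> x W0 W' r [<- ->]; constructor.
Qed.

Lemma red_size W W' : red W W' -> (size W' < size W)%N.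
Proof. by elim=> //= *; rewrite ltnS //; apply: leqW. Qed.

Lemma red_keeps_zero W W' : red W W' -> ~~ zero_free W -> ~~ zero_free W'.
Proof.
elim=> //= [b s t q||x W0 W0' _ IH]; first by case: letter_ofP.
  by move=> b c u v w x z m q _ _ _ _; case: letter_ofP.
by rewrite !negb_and => /orP[->//|/IH ->]; rewrite orbT.
Qed.

Definition reds : word -> word -> Prop := clos_refl_trans word red.

Lemma reds_cons x W W' : reds W W' -> reds (x :: W) (x :: W').
Proof.
elim=> [U V h|U|U V T _ IH1 _ IH2]; first by apply: rt_step; apply: red_cons.
  exact: rt_refl.
exact: rt_trans IH1 IH2.
Qed.

Lemma reds_zero W : ~~ zero_free W -> reds W [:: None].
Proof.
elim: W => [//|[a|] W IH] /=.
  move=> /IH/(reds_cons (Some a)) h; apply: rt_trans h _.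
  by apply: rt_step; apply: red_zr.
move=> _ {IH}; elim: W => [|x W IH]; first exact: rt_refl.
by apply: rt_trans IH; apply: rt_step; apply: red_zl.
Qed.

(** * Moving factors along a string *)

(** Two strings are related when one arises from the other by choosing, for
    every pair of neighbours of opposite signs, an invertible factor, and
    multiplying both neighbours by it on the sides that face each other. A pair
    (s, bar t) becomes (sh, bar (th)): in the product of [t]'s own sign, [h]
    acts on the left. So [g], with inverse [g'], is the factor that comes from
    the preceding letter, of sign [~~ c]; it must be trivial if the string is
    empty or if its first letter does not have sign [c]. The same inverse must
    serve both neighbours, which makes the relation symmetric. *)
Fixpoint eqv (c : bool) (g g' : option S) (W W' : word) : Prop :=
  match W, W' with
  | [::], [::] => g = None /\ g' = None
  | Some (b, s) :: V, Some (b', s') :: V' =>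
      [/\ b' = b, b = c \/ g = None /\ g' = None
        & exists h h', [/\ emb s' = g *[b] emb s *[b] h,
            g' *[b] (g *[b] emb s) = emb s, emb s *[b] h *[b] h' = emb s
            & eqv (~~ b) h h' V V']]
  | _, _ => False
  end.

Lemma eqv_zero_free c g g' W W' : eqv c g g' W W' -> zero_free W && zero_free W'.
Proof.
elim: W W' c g g' => [|[[b s]|] W IH] [|[[b' s']|] W'] c g g' //=.
by case=> _ _ [h [h' [_ _ _ /IH]]].
Qed.

Lemma eqv_any d c W W' : eqv c None None W W' -> eqv d None None W W'.
Proof.
case: W W' => [|[[b s]|] W] [|[[b' s']|] W'] //= [-> _ h].
by split=> //; right.
Qed.

Lemma eqv_cons b s c W W' : eqv (~~ b) None None W W' ->
  eqv c None None (Some (b, s) :: W) (Some (b, s) :: W').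
Proof. by move=> h; split=> //; [right|exists None, None]. Qed.

Lemma eqv_refl c W : zero_free W -> eqv c None None W W.
Proof.
by elim: W c => [|[[b s]|] W IH] c //= h; apply: eqv_cons; apply: IH.
Qed.

Lemma eqv_sym c g g' W W' : eqv c g g' W W' -> eqv c g' g W' W.
Proof.
elim: W W' c g g' => [|[[b s]|] W IH] [|[[b' s']|] W'] c g g' //=; first by case.
case=> -> bc [h [h' [es gs sh /IH e]]]; split=> //.
  by case: bc; [left|case; right].
exists h', h; split=> //; rewrite es -?mulA.
- by rewrite (cancel_l _ gs) (cancel_r1 sh).
- by rewrite (cancel_l _ gs).
- by rewrite (cancel_r _ sh).
Qed.

Lemma eqv_trans c g g' k k' W W' W'' : eqv c g g' W W' -> eqv c k k' W' W'' ->
  eqv c (k *[c] g) (g' *[c] k') W W''.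
Proof.
elim: W W' W'' c g g' k k' =>
  [|[[b s]|] W IH] [|[[b' s']|] W'] [|[[b'' s'']|] W''] //= c g g' k k'.
  by move=> [-> ->] [-> ->].
move=> [-> bc [h [h' [es gs sh e]]]] [-> bc' [l [l' [es' ks sl e']]]].
have -> : k *[c] g = k *[b] g.
  by case: bc => [->//|[-> _]]; case: bc' => [->//|[-> _]].
have -> : g' *[c] k' = g' *[b] k'.
  by case: bc => [->//|[_ ->]]; case: bc' => [->//|[_ ->]].
split=> //.
  by case: bc => [|[-> ->]]; [left|case: bc' => [|[-> ->]]; [left|right]].
exists (h *[b] l), (l' *[b] h').
have sl1 : emb s *[b] (h *[b] (l *[b] l')) = emb s *[b] h.
  move: sl; rewrite es => /(congr1 (mul b g')).
  by rewrite -?mulA !(cancel_l _ gs).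
have ks1 : k' *[b] (k *[b] (g *[b] emb s)) = g *[b] emb s.
  move: ks; rewrite es => /(congr1 (fun x => x *[b] h')).
  by rewrite -?mulA !(cancel_r1 sh).
split; rewrite -?mulA.
- by rewrite es' es -?mulA.
- by rewrite ks1 gs.
- by rewrite !mulA -[_ *[b] l *[b] l']mulA -[_ *[b] (l *[b] l')]mulA sl1.
- by have := IH _ _ _ _ _ _ _ e e'; rewrite !mulN.
Qed.

Lemma lenzP b (s t : nz) :
  le b (val s) (val t) <-> exists x, emb s = x *[b] emb t.
Proof. exact: leP. Qed.

(** Common factors on the right preserve divisibility on the right; so do
    factors on the left, provided that the one of the multiple can be undone. *)
Lemma le_move b g h k k' s s' t t' :
  emb s' = g *[b] emb s *[b] h ->
  emb t' = k *[b] emb t *[b] h -> k' *[b] (k *[b] emb t) = emb t ->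
  le b (val s) (val t) -> le b (val s') (val t').
Proof.
move=> es et kt /lenzP[x hx]; apply/lenzP; exists (g *[b] x *[b] k').
by rewrite es et hx -?mulA (cancel_l _ kt).
Qed.

Definition both_zero (W W' : word) := ~~ zero_free W /\ ~~ zero_free W'.

(** Strings with a letter 0 all collapse to (0), and are identified. *)
Definition sim W W' := both_zero W W' \/ eqv false None None W W'.

Lemma eqv_letter_of c b g g' m m' h h' q q' :
  b = c \/ g = None /\ g' = None -> eqv (~~ b) h h' q q' ->
  Some m' = g *[b] Some m *[b] h ->
  g' *[b] (g *[b] Some m) = Some m -> Some m *[b] h *[b] h' = Some m ->
  both_zero (letter_of b m :: q) (letter_of b m' :: q') \/
  eqv c g g' (letter_of b m :: q) (letter_of b m' :: q').
Proof.
move=> bc e em gm mh; case: letter_ofP => [u uE|zm].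
  case: letter_ofP => [u' uE'|zm']; last first.
    case: (nonzeroP (s := u)).
    rewrite uE (mul_zero (b := b) (g := g') (h := h') zm' (y := m)) //.
    by rewrite em -?mulA (cancel_r1 mh).
  by right; split=> //; exists h, h'; rewrite /emb uE uE'.
by left; rewrite (mul_zero zm em) (letter_of_zero _ zm).
Qed.

Lemma eqv_inv c g g' b s V W' : eqv c g g' (Some (b, s) :: V) W' ->
  exists s' h h' V', W' = Some (b, s') :: V' /\
    [/\ b = c \/ g = None /\ g' = None, emb s' = g *[b] emb s *[b] h,
        g' *[b] (g *[b] emb s) = emb s, emb s *[b] h *[b] h' = emb s
      & eqv (~~ b) h h' V V'].
Proof.
case: W' => [|[[b' s']|] V'] //= [-> bc [h [h' [es gs sh e]]]].
by exists s', h, h', V'.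
Qed.

Lemma eqv_inv_opposite c b g g' s V W' : c = ~~ b ->
  eqv c g g' (Some (b, s) :: V) W' ->
  exists s' h h' V', W' = Some (b, s') :: V' /\
    [/\ g = None /\ g' = None, emb s' = emb s *[b] h, emb s *[b] h *[b] h' = emb s
      & eqv (~~ b) h h' V V'].
Proof.
move=> -> /eqv_inv[s' [h [h' [V' [-> [bc es gs sh e]]]]]].
exists s', h, h', V'; split=> //.
have [gN gN'] : g = None /\ g' = None by case: bc => //; case: (b).
by split=> //; rewrite es gN.
Qed.

Arguments eqv : simpl never.

(** Moving factors neither destroys nor creates redexes: the order relations
    between neighbours are invariant, and a factor between two letters that
    get multiplied together cancels against its inverse. *)
Lemma eqv_red c g g' W W' V : eqv c g g' W W' -> red W V ->
  exists2 V', red W' V' & both_zero V V' \/ eqv c g g' V V'.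
Proof.
move=> e r; elim: r c g g' W' e => {W V}.
- move=> b s t q c g g' W' /eqv_inv[s' [h [h' [V' [-> [bc es gs sh]]]]]].
  move=> /(eqv_inv_opposite erefl)[t' [k [k' [q' [-> [[hN hN'] et tk e]]]]]].
  subst h h'; rewrite mulx1 in es.
  exists (letter_of b (op b (val s') (val t')) :: q'); first exact: red_mul.
  have eop u v : Some (op b (val u) (val v)) = emb u *[b] emb v by [].
  apply: (eqv_letter_of bc e); rewrite ?eop ?es ?et -?mulA //.
    by rewrite (cancel_l _ gs).
  by rewrite (cancel_r1 tk).
- by [].
- by move=> [[b s]|] q c g g' W' // /eqv_inv[? [? [? [? [_ []]]]]].
- move=> b d s t q -> ncst c g g' W' /eqv_inv[s' [h [h' [V' [-> [bc es gs sh]]]]]].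
  move=> /eqv_inv[t' [k [k' [q' [-> [_ et ht tk e]]]]]].
  rewrite !mulN in et ht tk.
  exists (None :: q'); last by left.
  have es' : emb s = g' *[b] emb s' *[b] h'.
    by rewrite es -?mulA (cancel_l _ gs) (cancel_r1 sh).
  have et' : emb t = k' *[b] emb t' *[b] h'.
    by rewrite et -?mulA (cancel_l _ tk) (cancel_r1 ht).
  apply: red_inc => // -[] h1; apply: ncst; [left|right].
    by apply: le_move es' et' _ h1; rewrite et -?mulA (cancel_l _ tk).
  by apply: le_move et' es' _ h1; rewrite es -?mulA (cancel_l _ gs).
- move=> b d u v w x z m q -> ux wz mE c g g' W'.
  move=> /eqv_inv[u' [h [h' [? [-> [bc eu gu uh]]]]]].
  move=> /eqv_inv[v' [k [k' [? [-> [_ ev hv vk]]]]]].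
  rewrite negbK => /eqv_inv[w' [l [l' [q' [-> [_ ew kw wl e]]]]]].
  rewrite !mulN in ev hv vk.
  have um : Some m = emb u *[b] z by rewrite mE ux.
  have mw : Some m = x *[b] emb w by rewrite mE wz mulA.
  have em : Some (odflt m (g *[b] Some m *[b] l)) = g *[b] Some m *[b] l.
    by case: (g) (l) => [?|] [?|].
  set m' := odflt _ _ in em.
  exists (letter_of b m' :: q').
    apply: (red_meet (x := g *[b] x *[b] k') (z := h' *[b] z *[b] l)) => //.
    + by rewrite eu ev ux -?mulA (cancel_l _ vk).
    + by rewrite ew ev wz -?mulA (cancel_r _ hv).
    + by rewrite em mE ev -?mulA (cancel_l _ vk) (cancel_r _ hv).
  apply: (eqv_letter_of bc e em).
    by rewrite um (cancel_l _ gu).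
  by rewrite mw -?mulA (cancel_r1 wl).
- move=> [[b s]|] W V r IH c g g' W' //.
  move=> /eqv_inv[s' [h [h' [V' [-> [bc es gs sh /IH[V'' r' dV]]]]]]].
  exists (Some (b, s') :: V''); first exact: red_cons.
  case: dV => [dV|e]; [left|right]; first by rewrite /both_zero.
  by split=> //; exists h, h'.
Qed.

(** * Local confluence modulo moved factors *)

Definition join V1 V2 := exists Z1 Z2, [/\ reds V1 Z1, reds V2 Z2 & sim Z1 Z2].

Lemma sim_refl W : sim W W.
Proof.
case: (boolP (zero_free W)) => h; first by right; apply: eqv_refl.
by left.
Qed.

Lemma sim_sym W W' : sim W W' -> sim W' W.
Proof. by case=> [[]|/eqv_sym]; [left|right]. Qed.

Lemma sim_cons x W W' : sim W W' -> sim (x :: W) (x :: W').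
Proof.
case: x => [[b s]|]; last by left.
case=> [[h h']|h]; [left|right]; first by [].
by apply: eqv_cons; apply: eqv_any h.
Qed.

Lemma join_sym V1 V2 : join V1 V2 -> join V2 V1.
Proof. by case=> Z1 [Z2 [h1 h2 /sim_sym h]]; exists Z2, Z1. Qed.

Lemma join_cons x V1 V2 : join V1 V2 -> join (x :: V1) (x :: V2).
Proof.
case=> Z1 [Z2 [h1 h2 h]]; exists (x :: Z1), (x :: Z2).
by split; [apply: reds_cons|apply: reds_cons|apply: sim_cons].
Qed.

Lemma join_refl V : join V V.
Proof. by exists V, V; split; [apply: rt_refl|apply: rt_refl|apply: sim_refl]. Qed.

Lemma join_red V1 V2 Z : red V1 Z -> red V2 Z -> join V1 V2.
Proof.
by move=> h1 h2; exists Z, Z; split; [apply: rt_step|apply: rt_step|apply: sim_refl].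
Qed.

Lemma join_sim V1 V2 : sim V1 V2 -> join V1 V2.
Proof. by exists V1, V2; split=> //; apply: rt_refl. Qed.

(** Peaks involving a 0 are joined by showing that both sides can reach a 0. *)
Definition doomed V := exists2 Z, reds V Z & ~~ zero_free Z.

Lemma doomed_zero V : ~~ zero_free V -> doomed V.
Proof. by exists V => //; apply: rt_refl. Qed.

Lemma doomed_red V Z : red V Z -> ~~ zero_free Z -> doomed V.
Proof. by exists Z => //; apply: rt_step. Qed.

Lemma join_doomed V1 V2 : doomed V1 -> doomed V2 -> join V1 V2.
Proof. by case=> [Z1 h1 d1] [Z2 h2 d2]; exists Z1, Z2; split=> //; left. Qed.

Section Confluence.
Hypothesis unam : unambiguous S.

(** Unambiguity enters here: an element incomparable with [t] is incomparable
    with all nonzero elements below [t]. Hence two neighbours that may be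
    replaced by 0 still may, or contain 0, after one of them has been multiplied
    by its other neighbour. *)
Lemma incomparable_below b (s t u : nz) :
  ~ comparable b (val s) (val t) -> le b (val u) (val t) ->
  ~ comparable b (val s) (val u).
Proof.
move=> ncst ut [su|us]; apply: ncst; first by left; apply: le_trans su ut.
exact: unambiguousP us ut.
Qed.

Lemma comparable_sym b s t : comparable b s t -> comparable b t s.
Proof. by case; [right|left]. Qed.

Lemma doomed_inc_r b c (s t : nz) m q : c = ~~ b ->
  ~ comparable b (val s) (val t) -> le b m (val t) ->
  doomed (Some (b, s) :: letter_of c m :: q).
Proof.
move=> cb ncst; case: letter_ofP => [u <- ut|_ _]; last exact: doomed_zero.
by apply: doomed_red (red_inc _ cb _) _ => //; apply: incomparable_below ut.
Qed.

Lemma doomed_inc_l b c (s t : nz) m q : c = ~~ b ->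
  ~ comparable b (val s) (val t) -> le b m (val s) ->
  doomed (letter_of b m :: Some (c, t) :: q).
Proof.
move=> cb ncst; case: letter_ofP => [u <- us|_ _]; last exact: doomed_zero.
apply: doomed_red (red_inc _ cb _) _ => // /comparable_sym.
by apply: incomparable_below us => /comparable_sym.
Qed.

(** The multipliers in the two divisibilities are not unique, but their effect
    on [v] is. *)
Lemma meet_unique b (v : nz) x z x' z' m m' u w :
  emb u = x *[b] emb v -> emb w = emb v *[b] z ->
  emb u = x' *[b] emb v -> emb w = emb v *[b] z' ->
  Some m = x *[b] emb v *[b] z -> Some m' = x' *[b] emb v *[b] z' -> m = m'.
Proof.
move=> h1 h2 h3 h4 h5 h6; suff: Some m = Some m' by case.
by rewrite h5 h6 -h3 h1 -mulA -h2 h4 mulA.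
Qed.

Lemma op_zero_l b m u : is_zero m -> op b m u = m.
Proof. by move=> h; apply: (mul_zero (b := b) (g := None) (h := Some u) h). Qed.

Lemma op_zero_r b m u : is_zero m -> op b u m = m.
Proof. by move=> h; apply: (mul_zero (b := b) (g := Some u) (h := None) h). Qed.

Lemma red_letter_of_mul_l b m u q :
  red (letter_of b m :: Some (b, u) :: q) (letter_of b (op b m (val u)) :: q).
Proof.
case: (letter_ofP b m) => [m' <-|zm]; first exact: red_mul.
by rewrite op_zero_l // letter_of_zero //; apply: red_zl.
Qed.

Lemma red_letter_of_mul_r b m s q :
  red (Some (b, s) :: letter_of b m :: q) (letter_of b (op b (val s) m) :: q).
Proof.
case: (letter_ofP b m) => [m' <-|zm]; first exact: red_mul.
by rewrite op_zero_r // letter_of_zero //; apply: red_zr.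
Qed.

Lemma reds_letter_of_meet_l b c u v w x z m q : c = ~~ b ->
  Some u = x *[b] emb v -> emb w = emb v *[b] z -> Some m = x *[b] emb v *[b] z ->
  reds (letter_of b u :: Some (c, v) :: Some (b, w) :: q) (letter_of b m :: q).
Proof.
move=> cb hu hw hm; case: (letter_ofP b u) => [u' uE|zu].
  by apply: rt_step; apply: red_meet hw hm; rewrite // /emb uE.
have -> : m = u by apply: (mul_zero (g := None) (h := z) (b := b)); rewrite // hm hu.
rewrite (letter_of_zero _ zu).
apply: rt_trans (_ : reds _ (None :: Some (b, w) :: q)) _.
  by apply: rt_step; apply: red_zl.
by apply: rt_step; apply: red_zl.
Qed.

Lemma reds_letter_of_meet_r b c u v w x z m q : c = ~~ b ->
  emb u = x *[b] emb v -> Some w = emb v *[b] z -> Some m = x *[b] emb v *[b] z ->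
  reds (Some (b, u) :: Some (c, v) :: letter_of b w :: q) (letter_of b m :: q).
Proof.
move=> cb hu hw hm; case: (letter_ofP b w) => [w' wE|zw].
  by apply: rt_step; apply: red_meet hm; rewrite // /emb wE.
have -> : m = w.
  by apply: (mul_zero (g := x) (h := None) (b := b)); rewrite // hm hw mulx1 mulA.
rewrite (letter_of_zero _ zw).
apply: rt_trans (_ : reds _ (Some (b, u) :: None :: q)) _.
  by apply: reds_cons; apply: rt_step; apply: red_zr.
by apply: rt_step; apply: red_zr.
Qed.

Lemma SomeM b u v : Some (op b u v) = Some u *[b] Some v.
Proof. by []. Qed.

Lemma op_le_r b s t : le b (op b s t) t.
Proof. by apply/leP; exists (Some s). Qed.

Lemma op_le_l b c s t : c = ~~ b -> le c (op b s t) s.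
Proof. by move=> ->; apply/leP; exists (Some t); rewrite mulN. Qed.

Lemma local_mul b s t q V : zero_free q -> red (Some (b, t) :: q) V ->
  join (letter_of b (op b (val s) (val t)) :: q) (Some (b, s) :: V).
Proof.
move=> lq /red_inv[//|t0 q0 Eq|t0 q0 Eq nc|v w x z m q0 Eq h1 h2 h3|q' r].
- rewrite Eq; apply: (join_red (red_letter_of_mul_l _ _ _ _)).
  suff -> : op b (op b (val s) (val t)) (val t0)
      = op b (val s) (op b (val t) (val t0)).
    exact: red_letter_of_mul_r.
  by apply: Some_inj; rewrite !SomeM mulA.
- rewrite Eq; apply: join_doomed; last exact: doomed_zero.
  by apply: doomed_inc_l nc _ => //; apply: op_le_r.
- pose Z := letter_of b (op b (val s) m) :: q0.
  rewrite Eq; exists Z, Z; split.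
  + apply: (reds_letter_of_meet_l (x := emb s *[b] x) _ _ _ h2) => //.
      by rewrite SomeM -!/(emb _) h1 mulA.
    by rewrite SomeM h3 !mulA.
  + by apply: rt_step; apply: red_letter_of_mul_r.
  + exact: sim_refl.
- by apply: (join_red (red_cons _ r)); apply: red_mul.
Qed.

Lemma local_inc b c s t q V : zero_free q -> c = ~~ b ->
  ~ comparable b (val s) (val t) -> red (Some (c, t) :: q) V ->
  doomed (Some (b, s) :: V).
Proof.
move=> lq cb nc /red_inv[//|t0 q0 _|t0 q0 _ _|v w x z m q0 _ h1 h2 h3|q' r].
- by apply: doomed_inc_r nc _ => //; apply: op_le_l; rewrite cb negbK.
- exact: doomed_zero.
- apply: doomed_inc_r nc _ => //; apply/leP; exists z.
  by rewrite h3 cb -[Some (val t)]/(emb t) h1 !mulN cb mulN.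
- by apply: doomed_red (red_inc _ cb nc) _.
Qed.

(** The one overlap that is not joined on the nose is (u, bar v, w, bar t) with
    [v] and [w] dividing each other: contracting the first three letters or the
    last three gives pairs that differ by a factor moved along their edge. *)
Lemma local_meet b c u v w x z m q V : zero_free q -> c = ~~ b ->
  emb u = x *[b] emb v -> emb w = emb v *[b] z -> Some m = x *[b] emb v *[b] z ->
  red (Some (c, v) :: Some (b, w) :: q) V ->
  join (letter_of b m :: q) (Some (b, u) :: V).
Proof.
move=> lq cb hu hw hm /red_inv[//|t0 q0 []|t0 q0 [_ <- _] nc|v' w' x' z' m' q0|].
- by rewrite cb; case: (b).
- by case: nc; right; apply/lenzP; exists z; rewrite cb mulN.
- subst c; case=> _ <- Eq h1 h2 h3; subst q; rewrite !mulN in h1 h2 h3.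
  have um : emb u = Some m *[b] x' by rewrite hm hu [in LHS]h1 hw -?mulA.
  have mu : Some m = emb u *[b] z by rewrite hm hu.
  have wm : emb w' = Some m' *[b] z by rewrite h3 -h1 h2 hw mulA.
  have mw : Some m' = emb w' *[b] x' by rewrite h3 h2 mulA.
  case: (letter_ofP b m) => [m0 E|zm]; last first.
    case: (nonzeroP (s := u)); suff -> : val u = m by [].
    exact: (mul_zero (g := None) zm um).
  case: (letter_ofP (~~ b) m') => [m0' E'|zm]; last first.
    case: (nonzeroP (s := w')); suff -> : val w' = m' by [].
    exact: (mul_zero (g := None) zm wm).
  apply: join_sim; right; split=> //; first by right.
  exists x', z; split=> //; rewrite /emb ?E //; first by rewrite -um -mu.
  split=> //; first by left.
  exists None, None; split=> //; rewrite ?mulN ?mulx1 /emb ?E' -?/(emb _) //.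
    by rewrite -mw -wm.
  by apply: eqv_refl; case/andP: lq.
move=> q' /red_inv[//|t0 q0 Eq|t0 q0 Eq nc|v' w' x' z' m' q0 Eq h1 h2 h3|q1 r].
- have hm' : Some (op b m (val t0)) = x *[b] emb v *[b] (z *[b] emb t0).
    by rewrite SomeM hm -?mulA.
  pose Z := letter_of b (op b m (val t0)) :: q0.
  rewrite Eq; exists Z, Z.
  split; [|apply: (reds_letter_of_meet_r _ cb hu _ hm')|exact: sim_refl].
    by apply: rt_step; apply: red_letter_of_mul_l.
  by rewrite SomeM mulA -hw.
- rewrite Eq; apply: join_doomed; last exact: doomed_zero.
  apply: doomed_inc_l nc _ => //.
  by apply/leP; exists x; rewrite hm -mulA -hw.
- pose m2 := odflt m (Some m *[b] z').
  have hm2 : Some m2 = Some m *[b] z' by rewrite /m2; case: (z').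
  rewrite Eq; exists (letter_of b m2 :: q0), (letter_of b m2 :: q0).
  split; last exact: sim_refl.
    apply: (reds_letter_of_meet_l (x := x *[b] x') _ _ _ h2) => //.
      by rewrite hm -?mulA -hw h1.
    by rewrite hm2 hm -(mulA b x) -hw h1 !mulA.
  refine (@reds_letter_of_meet_r b c u v m' x (z *[b] z') m2 q0 cb hu _ _).
    by rewrite h3 mulA -hw h1.
  by rewrite hm2 hm -?mulA.
- apply: (join_red (red_cons _ r)); exact: red_meet hm.
Qed.

Theorem red_local W V1 V2 : red W V1 -> red W V2 -> join V1 V2.
Proof.
case: (boolP (zero_free W)) => [lW r1|dW r1 r2]; last first.
  by apply: join_doomed; apply: doomed_zero; apply: red_keeps_zero dW.
elim: r1 lW V2 => {W V1}.
- move=> b s t q lq V /red_inv[//|t0 q0 [<- <-]|t0 q0 [] |v w x z m q0 []|W' r].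
  + exact: join_refl.
  + by case: (b).
  + by case: (b).
  + exact: local_mul.
- by [].
- by case=> [[b s]|].
- move=> b c s t q cb nc lq V.
  move=> /red_inv[//|t0 q0 []|t0 q0 [_ _ <-] _|v w x z m q0 [_ <- _] h1 _ _|W' r].
  + by rewrite cb; case: (b).
  + exact: join_refl.
  + by case: nc; left; apply/lenzP; exists x.
  + by apply: join_doomed; [apply: doomed_zero|apply: local_inc cb nc r].
- move=> b c u v w x z m q cb hu hw hm lq V.
  move=> /red_inv[//|t0 q0 []|t0 q0 [_ <- _] nc
    |v0 w0 x0 z0 m0 q0 [_ <- <- <-] h1 h2 h3|W' r].
  + by rewrite cb; case: (b).
  + by case: nc; left; apply/lenzP; exists x.
  + by rewrite (meet_unique hu hw h1 h2 hm h3); apply: join_refl.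
  + exact: local_meet cb hu hw hm r.
- move=> [[b s]|] W V1 r1 IH // lW V2 r2.
  have [t q EW|t q EW nc|v w x z m q EW h1 h2 h3|V3 r3] := red_inv (W := W) lW r2.
  + by rewrite EW in r1 lW; apply: join_sym; apply: local_mul r1.
  + rewrite EW in r1 lW; apply: join_doomed; last exact: doomed_zero.
    exact: local_inc nc r1.
  + by rewrite EW in r1 lW; apply: join_sym; apply: local_meet h1 h2 h3 r1.
  + by apply: join_cons; apply: IH.
Qed.

Definition reduced W := forall V, ~ red W V.
Definition reduces_to W V := reds W V /\ reduced V.

Lemma reds_size W V : reds W V -> (size V <= size W)%N.
Proof.
elim=> [U T /red_size/ltnW //|//|U T X _ h1 _ h2].
exact: leq_trans h2 h1.
Qed.

Lemma reduces_to_exists W : exists V, reduces_to W V.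
Proof.
have [n] := ubnP (size W); elim: n W => // n IH W hW.
case: (pselect (reduced W)) => [h|/existsNP[V /contrapT r]].
  by exists W; split=> //; apply: rt_refl.
have [] := IH V; first exact: leq_trans (red_size r) hW.
by move=> U [h1 h2]; exists U; split=> //; apply: rt_trans (rt_step _ _ _ _ r) h1.
Qed.

Lemma reds_first W V : reds W V -> W = V \/ exists2 U, red W U & reds U V.
Proof.
move=> /clos_rt_rt1n_iff; case=> [|U V' r h]; first by left.
by right; exists U => //; apply/clos_rt_rt1n_iff.
Qed.

Lemma reduced_zero V : reduced V -> ~~ zero_free V -> V = [:: None].
Proof.
by move=> rV /reds_zero/reds_first[//|[U r _]]; case: (rV U).
Qed.

Lemma reds_keep_zero W V : reds W V -> ~~ zero_free W -> ~~ zero_free V.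
Proof. by elim=> [U T /red_keeps_zero //|//|U T X _ h1 _ h2 /h1/h2]. Qed.

Lemma sim_trans W W' W'' : sim W W' -> sim W' W'' -> sim W W''.
Proof.
case=> [[h1 h2]|e1] [[h3 h4]|e2]; first by left.
- by case/andP: (eqv_zero_free e2) h2 => ->.
- by case/andP: (eqv_zero_free e1) h3 => _ ->.
- by right; have := eqv_trans e1 e2.
Qed.

(** Newman's lemma modulo moved factors, by induction on the lengths: related
    strings make related steps, so a peak between related strings is a peak at
    one string up to [sim]. *)
Theorem reduced_form_unique W W' V V' : sim W W' ->
  reduces_to W V -> reduces_to W' V' -> sim V V'.
Proof.
have [n] := ubnP (maxn (size W) (size W')).
elim: n W W' V V' => // n IH W W' V V'; rewrite ltnS geq_max => /andP[hW hW'].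
case=> [[d d'] [r nV] [r' nV']|e [r nV] [r' nV']].
  by left; split; [apply: reds_keep_zero r d|apply: reds_keep_zero r' d'].
case/reds_first: r => [EW|[W1 r r1]].
  case/reds_first: r' => [EW'|[W1' r' _]]; first by right; rewrite -EW -EW'.
  have [U rU _] := eqv_red (eqv_sym e) r'.
  by case: (nV U); rewrite -EW.
have [U' rU' dU'] := eqv_red e r.
have {}dU' : sim W1 U' by [].
case/reds_first: r' => [EW'|[W1' r' r1']]; first by case: (nV' U'); rewrite -EW'.
have [Z1 [Z2 [h1 h2 h12]]] := red_local rU' r'.
have [T1 [rT1 nT1]] := reduces_to_exists Z1.
have [T2 [rT2 nT2]] := reduces_to_exists Z2.
have lt1 := leq_trans (red_size r) hW.
have lt2 := leq_trans (red_size rU') hW'.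
have lt3 := leq_trans (red_size r') hW'.
have s1 : sim V T1.
  apply: (IH W1 U') => //; first by rewrite gtn_max lt1.
  by split=> //; apply: rt_trans h1 rT1.
have s2 : sim T1 T2.
  apply: (IH Z1 Z2) => //; rewrite gtn_max.
  by rewrite (leq_ltn_trans (reds_size h1) lt2) (leq_ltn_trans (reds_size h2) lt3).
have s3 : sim T2 V'.
  apply: (IH W1' W1') => //; first by rewrite gtn_max lt3.
  - exact: sim_refl.
  - by split=> //; apply: rt_trans h2 rT2.
exact: sim_trans s1 (sim_trans s2 s3).
Qed.

End Confluence.

(** * Choosing representatives *)

Section Representatives.
Variables r ell : S -> S.
Hypothesis hrep : representatives r ell.

Definition rep (b : bool) : S -> S := if b then ell else r.

Definition equiv b s t := le b s t /\ le b t s.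

Lemma equiv_sym b s t : equiv b s t -> equiv b t s.
Proof. by case. Qed.

Lemma equiv_trans b t s u : equiv b s t -> equiv b t u -> equiv b s u.
Proof.
by move=> [h1 h2] [h3 h4]; split; [apply: le_trans h1 h3|apply: le_trans h4 h2].
Qed.

Lemma equiv_le_l b s s' t : equiv b s s' -> le b s t -> le b s' t.
Proof. by case=> _ h1 h2; apply: le_trans h1 h2. Qed.

Lemma equiv_le_r b s s' t : equiv b s s' -> le b t s -> le b t s'.
Proof. by case=> h1 _ h2; apply: le_trans h2 h1. Qed.

Lemma rep_class b s : equiv (~~ b) (rep b s) s.
Proof. by case: b; [apply: (repL_class hrep)|apply: (repR_class hrep)]. Qed.

Lemma rep_unique b s t : equiv (~~ b) s t -> rep b s = rep b t.
Proof. by case: b => h; [apply: (repL_unique hrep)|apply: (repR_unique hrep)]. Qed.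

Lemma rep_idem b s : rep b (rep b s) = rep b s.
Proof. exact: rep_unique (rep_class b s). Qed.

(** The compatibility conditions on representatives enter here: replacing [s]
    by the representative of one class does not spoil being a representative of
    the other class. Otherwise an element above both neighbours could be
    changed forever, from its two sides in turn. *)
Lemma rep_rep b s : rep (~~ b) s = s -> rep (~~ b) (rep b s) = rep b s.
Proof.
case: b => /= hs.
  have Ls := repL_class hrep s.
  have Rls := repR_class hrep (ell s).
  have L : eqL (r s) (r (ell s)).
    apply: (repR_D hrep); exists (ell s); rewrite hs; split; last first.
      by case: Rls.
    by case: Ls.
  symmetry; apply: (rep_H hrep); split; last by case: Rls.
  rewrite hs in L; exact: (equiv_trans (b := false) Ls L).
have Rs := repR_class hrep s.
have Lrs := repL_class hrep (r s).
have R : eqR (ell (r s)) (ell s).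
  apply: (repL_D hrep); exists (r s); rewrite hs; split; first exact: Lrs.
  exact: Rs.
apply: (rep_H hrep); split; first exact: Lrs.
rewrite hs in R; exact: (equiv_trans (b := true) R (equiv_sym (b := true) Rs)).
Qed.

(** The rules that replace the larger of two neighbours by a representative.
    The smaller one keeps its cofactor [x]. *)
Inductive choose : word -> word -> Prop :=
| choose_down b c s t s' t' x q : c = ~~ b ->
    lt b (val t) (val s) -> val s <> rep b (val s) -> val s' = rep b (val s) ->
    emb t = x *[b] emb s -> emb t' = x *[b] emb s' ->
    choose (Some (b, s) :: Some (c, t) :: q) (Some (b, s') :: Some (c, t') :: q)
| choose_up b c s t s' t' x q : c = ~~ b ->
    le b (val s) (val t) -> val t <> rep b (val t) -> val t' = rep b (val t) ->
    emb s = x *[b] emb t -> emb s' = x *[b] emb t' ->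
    choose (Some (b, s) :: Some (c, t) :: q) (Some (b, s') :: Some (c, t') :: q)
| choose_cons x W W' : choose W W' -> choose (x :: W) (x :: W').

Lemma rep_factor b (s s' : nz) : val s' = rep b (val s) ->
  exists y y', emb s' = emb s *[b] y /\ emb s *[b] y *[b] y' = emb s.
Proof.
move=> es; have := rep_class b (val s); rewrite -es.
move=> [/lenzP[y hy] /lenzP[y' hy']].
rewrite !mulN in hy hy'; exists y, y'; split=> //.
by rewrite -hy -hy'.
Qed.

(** The factor [y] that turns the larger element into its representative also
    turns the smaller one into its new value, since the cofactor is kept. *)
Lemma move_sim b c s s' t t' y y' q : c = ~~ b ->
  emb s' = emb s *[b] y -> emb s *[b] y *[b] y' = emb s ->
  emb t' = emb t *[b] y -> emb t *[b] y *[b] y' = emb t ->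
  sim (Some (b, s) :: Some (c, t) :: q) (Some (b, s') :: Some (c, t') :: q).
Proof.
move=> -> es ys et yt; case: (boolP (zero_free q)) => lq; last by left.
right; split=> //; first by right.
exists y, y'; split=> //.
split=> //; first by left.
exists None, None; rewrite !mulN; split; rewrite ?mulx1 //.
exact: eqv_refl.
Qed.

Lemma choose_sim W W' : choose W W' -> sim W W'.
Proof.
elim=> {W W'}; last by move=> x W W' _; apply: sim_cons.
- move=> b c s t s' t' x q cb _ _ /rep_factor[y [y' [es ys]]] et et'.
  apply: (move_sim _ cb es ys) => //; first by rewrite et' es et mulA.
  by rewrite et -?mulA (cancel_r1 ys).
- move=> b c s t s' t' x q cb _ _ /rep_factor[y [y' [et yt]]] es es'.
  apply: (move_sim _ cb _ _ et yt) => //; first by rewrite es' et es mulA.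
  by rewrite es -?mulA (cancel_r1 yt).
Qed.

(** * Termination *)

(** The cost of two neighbours whose larger element is not yet a
    representative: exponential in the number [n] of letters after [a] if the
    larger element is [a], and in the number [k] of letters before [a] if it is
    [c]. A choice at one edge may spoil only the next edge
    downhill, whose exponent is smaller by one. *)
Definition edge_cost (a c : option (bool * nz)) (n k : nat) : nat :=
  match a, c with
  | Some (p, s), Some (q, t) =>
      if q == ~~ p then
        `[< lt p (val t) (val s) /\ val s <> rep p (val s) >] * 2 ^ n
        + `[< le p (val s) (val t) /\ val t <> rep p (val t) >] * 2 ^ k
      else 0
  | _, _ => 0
  end.

Fixpoint cost (k : nat) (W : word) : nat :=
  match W with
  | a :: V => if V is c :: _ then edge_cost a c (size V) k + cost k.+1 V else 0
  | [::] => 0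
  end.

Lemma edge_costE b s t n k : edge_cost (Some (b, s)) (Some (~~ b, t)) n k =
  (`[< lt b (val t) (val s) /\ val s <> rep b (val s) >] * 2 ^ n
   + `[< le b (val s) (val t) /\ val t <> rep b (val t) >] * 2 ^ k)%N.
Proof. by rewrite /edge_cost eqxx. Qed.

Lemma costE k a c V :
  cost k [:: a, c & V] = (edge_cost a c (size V).+1 k + cost k.+1 (c :: V))%N.
Proof. by []. Qed.

Lemma leq_asbool (P Q : Prop) : (P -> Q) -> (`[< P >] <= `[< Q >])%N.
Proof. by move=> h; case: (asboolP P) => // /h hQ; rewrite asboolT. Qed.

Lemma lt_equiv_r b s s' t : equiv b s s' -> lt b t s' -> lt b t s.
Proof.
move=> e /ltE[h1 h2]; apply/ltE; split; first exact: equiv_le_r (equiv_sym e) h1.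
by move=> h; apply: h2; apply: equiv_le_l e h.
Qed.

Lemma lt_equiv_l b s s' t : equiv b s s' -> lt b s' t -> lt b s t.
Proof.
move=> e /ltE[h1 h2]; apply/ltE; split; first exact: equiv_le_l (equiv_sym e) h1.
by move=> h; apply: h2; apply: equiv_le_r e h.
Qed.

(** Replacing the left element within its class costs at most the weight of an
    edge that leads down from it, as the order relation is unchanged; it costs
    nothing when a representative remains one. Symmetrically on the right. *)
Lemma edge_cost_left b (s s' : nz) x n k : equiv b (val s) (val s') ->
  (edge_cost (Some (b, s')) x n k <= edge_cost (Some (b, s)) x n k + 2 ^ n)%N.
Proof.
move=> e; case: x => [[c t]|] //=; case: ifP => // _.
rewrite addnAC leq_add //.
  by rewrite (leq_trans (n := 1 * 2 ^ n)) ?leq_mul2r ?leq_b1 ?orbT // mul1n leq_addl.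
rewrite leq_mul2r; apply/orP; right; apply: leq_asbool => -[h1 h2]; split=> //.
exact: equiv_le_l (equiv_sym e) h1.
Qed.

Lemma edge_cost_left_rep b (s s' : nz) x n k : equiv b (val s) (val s') ->
  (val s = rep b (val s) -> val s' = rep b (val s')) ->
  (edge_cost (Some (b, s')) x n k <= edge_cost (Some (b, s)) x n k)%N.
Proof.
move=> e er; case: x => [[c t]|] //=; case: ifP => // _.
rewrite leq_add // leq_mul2r; apply/orP; right; apply: leq_asbool => -[h1 h2]; split=> //.
- exact: lt_equiv_r e h1.
- by move=> /er.
- exact: equiv_le_l (equiv_sym e) h1.
Qed.

Lemma edge_cost_right b (s s' : nz) x n k : equiv (~~ b) (val s) (val s') ->
  (edge_cost x (Some (b, s')) n k <= edge_cost x (Some (b, s)) n k + 2 ^ k)%N.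
Proof.
move=> e; case: x => [[c t]|] //=; case: eqP => // Eb; subst b; rewrite negbK in e.
rewrite -addnA leq_add //; last first.
  by rewrite (leq_trans (n := 1 * 2 ^ k)) ?leq_mul2r ?leq_b1 ?orbT // mul1n leq_addl.
rewrite leq_mul2r; apply/orP; right; apply: leq_asbool => -[h1 h2]; split=> //.
exact: lt_equiv_l e h1.
Qed.

Lemma edge_cost_right_rep b (s s' : nz) x n k : equiv (~~ b) (val s) (val s') ->
  (val s = rep (~~ b) (val s) -> val s' = rep (~~ b) (val s')) ->
  (edge_cost x (Some (b, s')) n k <= edge_cost x (Some (b, s)) n k)%N.
Proof.
move=> e er; case: x => [[c t]|] //=; case: eqP => // Eb; subst b.
rewrite negbK in e er.
rewrite leq_add // leq_mul2r; apply/orP; right; apply: leq_asbool => -[h1 h2]; split=> //.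
- exact: lt_equiv_l e h1.
- exact: equiv_le_r (equiv_sym e) h1.
- by move=> /er.
Qed.

Lemma equiv_move b (s s' : nz) y y' :
  emb s' = emb s *[b] y -> emb s *[b] y *[b] y' = emb s ->
  equiv (~~ b) (val s) (val s').
Proof.
move=> es ys; split; apply/lenzP; rewrite ?es.
  by exists y'; rewrite mulN.
by exists y; rewrite mulN.
Qed.

Lemma choose_size W W' : choose W W' -> size W' = size W.
Proof. by elim=> //= x V V' _ ->. Qed.

(** The extra letter [a] in front makes the edge to the left of the redex visible
    to the induction. *)
Lemma choose_cost W W' : choose W W' -> forall a k,
  (cost k (a :: W') < cost k (a :: W))%N.
Proof.
elim=> {W W'}.
- move=> b c s t s' t' x q -> lts ns es' et et' a k.
  have [y [y' [es ys]]] := rep_factor es'.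
  have et'' : emb t' = emb t *[b] y by rewrite et' es et mulA.
  have yt : emb t *[b] y *[b] y' = emb t by rewrite et -?mulA (cancel_r1 ys).
  have ets := equiv_move et'' yt; have ess := equiv_move es ys.
  have E1 : (edge_cost a (Some (b, s')) (size q).+2 k
      <= edge_cost a (Some (b, s)) (size q).+2 k)%N.
    by apply: edge_cost_right_rep => // h; rewrite es' rep_rep.
  have E2 : edge_cost (Some (b, s')) (Some (~~ b, t')) (size q).+1 k.+1 = 0%N.
    rewrite edge_costE asboolF ?asboolF //; last by case; rewrite es' rep_idem.
    move=> [h _]; move/ltE: lts => -[_]; apply.
    apply: (le_move (g := None) (k := None) (h := y') (k' := None)) h => //.
      by rewrite es ys.
    by rewrite et'' yt.
  have E3 : (2 ^ (size q).+1
      <= edge_cost (Some (b, s)) (Some (~~ b, t)) (size q).+1 k.+1)%N.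
    by rewrite edge_costE asboolT // mul1n leq_addr.
  have E4 : (cost k.+2 (Some (~~ b, t') :: q)
      < cost k.+2 (Some (~~ b, t) :: q) + 2 ^ (size q).+1)%N.
    case: q {E1 E2 E3} => [|x0 q]; first by rewrite expn_gt0.
    rewrite !costE addnAC ltn_add2r.
    apply: leq_ltn_trans (edge_cost_left _ _ _ ets) _.
    by rewrite ltn_add2l ltn_exp2l.
  rewrite !costE E2 add0n -addnS leq_add // (leq_trans E4) // addnC leq_add2r.
  exact: E3.
- move=> b c s t s' t' x q -> lest nt et' es es' a k.
  have [y [y' [et yt]]] := rep_factor et'.
  have es'' : emb s' = emb s *[b] y by rewrite es' et es mulA.
  have ys : emb s *[b] y *[b] y' = emb s by rewrite es -?mulA (cancel_r1 yt).
  have ets := equiv_move et yt; have ess := equiv_move es'' ys.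
  have E1 := edge_cost_right a (size q).+2 k ess.
  have E2 : edge_cost (Some (b, s')) (Some (~~ b, t')) (size q).+1 k.+1 = 0%N.
    rewrite edge_costE asboolF ?asboolF //; first by case; rewrite et' rep_idem.
    move=> [/ltE[_ h] _]; apply: h; apply/lenzP; by exists x.
  have E3 : (2 ^ k.+1
      <= edge_cost (Some (b, s)) (Some (~~ b, t)) (size q).+1 k.+1)%N.
    by rewrite edge_costE (asboolT (P := _ /\ _ <> rep b (val t))) // mul1n leq_addl.
  have E4 : (cost k.+2 (Some (~~ b, t') :: q) <= cost k.+2 (Some (~~ b, t) :: q))%N.
    case: q {E1 E2 E3} => [|x0 q] //.
    rewrite !costE leq_add2r; apply: edge_cost_left_rep => // h.
    by rewrite et' rep_rep.
  rewrite !costE E2 add0n addnA -addSn leq_add //.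
  apply: leq_ltn_trans E1 _; rewrite ltn_add2l; apply: leq_trans E3.
  by rewrite ltn_exp2l.
- move=> x W W' h IH a k.
  by rewrite !costE (choose_size h) ltn_add2l; apply: IH.
Qed.

Definition rewrites W W' := red W W' \/ choose W W'.

Lemma rewrites_wf W : Acc (fun V' V => rewrites V V') W.
Proof.
have [n] := ubnP (size W); elim: n W => [//|n IHn] W; rewrite ltnS => hW.
have [m] := ubnP (cost 0 (None :: W)); elim: m W hW => [//|m IHm] W hW.
rewrite ltnS => hc; constructor=> V [/red_size h|h].
  by apply: IHn; apply: leq_trans h hW.
apply: IHm; first by rewrite (choose_size h).
by apply: (leq_trans _ hc); apply: choose_cost.
Qed.

(** * Normal forms *)

(** Normal strings read from left to right: [shape] descends strictly to the
    letter [s] of some [valley b s V]; from there the string [V] ascends, weakly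
    at the first edge and strictly afterwards, by [up]. In [up] and [valley] the
    letter [s] of sign [b] is the one just before the string. *)
Fixpoint up (b : bool) (s : nz) (W : word) : Prop :=
  match W with
  | [::] => True
  | Some (c, t) :: V =>
      [/\ c = ~~ b, lt b (val s) (val t), val t = rep b (val t) & up c t V]
  | None :: _ => False
  end.

Definition valley (b : bool) (s : nz) (W : word) : Prop :=
  match W with
  | [::] => True
  | Some (c, t) :: V =>
      [/\ c = ~~ b, le b (val s) (val t), val t = rep b (val t) & up c t V]
  | None :: _ => False
  end.

Fixpoint shape (W : word) : Prop :=
  if W is Some (b, s) :: V then
    valley b s V \/
    (if V is Some (c, t) :: _ then
       [/\ c = ~~ b, lt b (val t) (val s), val s = rep b (val s) & shape V]
     else False)
  else False.

Lemma up_valley b s W : up b s W -> valley b s W.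
Proof.
by case: W => [|[[c t]|] W] //= [-> /ltE[h _] ht hW].
Qed.

Lemma shape_tail b s c t V :
  shape [:: Some (b, s), Some (c, t) & V] -> shape (Some (c, t) :: V).
Proof. by case=> -[_ _ _]; [move=> /up_valley; left|]. Qed.

Lemma irreducible_zero V : ~ rewrites [:: None] V.
Proof.
case=> h; first by inversion h as [| | | | |? ? ? h']; inversion h'.
by inversion h as [| |? ? ? h']; inversion h'.
Qed.

Lemma shape_irreducible W V : shape W -> ~ rewrites W V.
Proof.
move=> hW [h|h]; elim: h hW => {W V}.
- by move=> b s t q [[]|[]]; case: b.
- by [].
- by case=> [[b s]|] q //= [].
- move=> b c s t q -> nc [[_ h _ _]|[_ /ltE[h _] _ _]]; apply: nc; by [left|right].
- move=> b c u v w x z m q -> hu hw _.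
  have uv : le b (val u) (val v) by apply/lenzP; exists x.
  have wv : le (~~ b) (val w) (val v) by apply/lenzP; exists z; rewrite mulN.
  case=> [[_ _ _ [_ /ltE[_]]]|[_ /ltE[_]]] //.
- move=> [[b s]|] // [|[[c t]|] W] V h IH; first by inversion h.
    by move=> /shape_tail/IH.
  by case.
- move=> b c s t s' t' x q -> /ltE[_ nst] ns _ _ _ [[]|[_ _ e _]] //.
- move=> b c s t s' t' x q -> lst nt _ _ _ [[_ _ e _]|[_ /ltE[]]] //.
- move=> [[b s]|] // [|[[c t]|] W] V h IH; first by inversion h.
    by move=> /shape_tail/IH.
  by case.
Qed.

(** Factors of nonzero elements are nonzero, so they can occur as letters. *)
Lemma nonzero_factor b x (t : nz) m g h :
  Some m = x -> emb t = g *[b] (x *[b] h) -> exists t' : nz, val t' = m.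
Proof.
move=> <- et; case: (letter_ofP b m) => [t' <-|zm]; first by exists t'.
case: (nonzeroP (s := t)); suff -> : val t = m by [].
by apply: (mul_zero (b := b) (g := g) (h := h)); rewrite // -mulA.
Qed.

Lemma rep_exists b (s t : nz) x : emb t = x *[b] emb s ->
  exists s' t' : nz, val s' = rep b (val s) /\ emb t' = x *[b] emb s'.
Proof.
move=> et; have [/leP[y hy] /leP[y' hy']] := rep_class b (val s).
rewrite !mulN in hy hy'.
have [s' es'] := nonzero_factor (g := None) erefl hy'.
rewrite -es' in hy'.
have [m hm] : exists m, Some m = x *[b] emb s' by case: (x) => [a|]; eexists.
have [t' et'] : exists t' : nz, val t' = m.
  apply: (nonzero_factor (b := b) (t := t) (g := None) (h := y') hm).
  by rewrite et -mulA; congr (_ *[_] _).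
by exists s', t'; rewrite /emb et' hm.
Qed.

(** Once a string without redex goes up it keeps going up strictly: an element
    above both neighbours would be the middle of a redex of three letters. *)
Lemma irreducible_shape W : W <> [::] -> zero_free W ->
  (forall V, ~ rewrites W V) -> shape W.
Proof.
elim: W => [//|[[b s]|] // W IH] _.
case: W IH => [|[[c t]|] // V] IH lW irr; first by left.
have irrV : forall U, ~ rewrites (Some (c, t) :: V) U.
  move=> U [h|h]; apply: (irr (Some (b, s) :: U)); first by left; apply: red_cons.
  by right; apply: choose_cons.
have {IH irrV} sV := IH (fun e => ltac:(discriminate)) lW irrV.
have cb : c = ~~ b.
  case: (c =P ~~ b) => // ncb.
  have {ncb} E : c = b by case: (b) (c) ncb => [] [].
  by subst c; case: (irr _ (or_introl (red_mul _ _ _ _))).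
have [lst|nlst] := pselect (le b (val s) (val t)).
  left; split=> //.
    case: (pselect (val t = rep b (val t))) => // nt.
    have [x hx] := proj1 (lenzP _ _ _) lst.
    have [t' [s' [et' es']]] := rep_exists hx.
    by case: (irr _ (or_intror (choose_up _ cb lst nt et' hx es'))).
  have peak d u U : V = Some (d, u) :: U -> d = ~~ c -> ~ le c (val u) (val t).
    move=> EV dc ut; have [x hx] := proj1 (lenzP _ _ _) lst.
    have [z hz] := proj1 (lenzP _ _ _) ut.
    have db : d = b by rewrite dc cb negbK.
    rewrite cb mulN in hz.
    have [m hm] : exists m, Some m = x *[b] emb t *[b] z.
      by case: (x) (z) => [?|] [?|]; eexists.
    apply: (irr (letter_of b m :: U)); left; rewrite EV db.
    exact: red_meet hx hz hm.
  case: V sV peak {irr lW} => [|[[d u]|] V] //; last by case.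
  move=> [[dc ltu eu hV]|[dc /ltE[lut _] _ _]] peak; last first.
    by case: (peak _ _ _ erefl dc).
  by split=> //; apply/ltE; split=> //; apply: peak erefl dc.
right; have lts : le b (val t) (val s).
  case: (pselect (comparable b (val s) (val t))) => [[]//|nc].
  by case: (irr _ (or_introl (red_inc _ cb nc))).
have lt' : lt b (val t) (val s) by apply/ltE.
split=> //.
case: (pselect (val s = rep b (val s))) => // ns.
have [x hx] := proj1 (lenzP _ _ _) lts.
have [s' [t' [es' et']]] := rep_exists hx.
by case: (irr _ (or_intror (choose_down _ cb lt' ns es' hx et'))).
Qed.

(** From the right end inwards: the factor beyond [t] is trivial on [t] by
    induction, so the two versions of [t] are in one class; both are its
    representative, hence equal, and the factor before [t] is trivial on [t],
    thus on every multiple of [t], in particular on [s]. *)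
Lemma valley_unique b s s' h h' V V' : valley b s V -> valley b s' V' ->
  eqv (~~ b) h h' V V' -> V = V' /\ emb s *[b] h = emb s.
Proof.
elim: V b s s' h h' V' => [|[[c t]|] V IH] b s s' h h' [|[[c' t']|] V'] //.
  by move=> _ _ [-> _]; rewrite mulx1.
move=> [-> lst et hV] [-> _ et' hV'].
move=> /eqv_inv[t0 [k [k' [V0 [[<- <-] [_ e ht tk e']]]]]].
have [EV tk1] := IH _ _ _ _ _ _ (up_valley hV) (up_valley hV') e'.
have e1 : emb t' = emb t *[b] h by rewrite e -mulA tk1 mulN.
have e2 : emb t *[b] h *[b] h' = emb t by rewrite -[RHS]ht !mulN.
have Et : t = t'.
  apply: val_inj; rewrite et et'; apply: rep_unique; exact: equiv_move e1 e2.
rewrite -EV -Et; split=> //.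
have /lenzP[x ->] := lst.
by rewrite -mulA -e1 Et.
Qed.

Lemma eqv_le_down c g g' b s t V s' t' V' :
  eqv c g g' [:: Some (b, s), Some (~~ b, t) & V]
    [:: Some (b, s'), Some (~~ b, t') & V'] ->
  (le b (val s) (val t) -> le b (val s') (val t')) /\
  (le b (val t) (val s) -> le b (val t') (val s')).
Proof.
move=> /eqv_inv[s0 [h [h' [_ [[<- <-] [_ es gs sh]]]]]].
move=> /eqv_inv[t0 [k [k' [_ [[<- _] [_ et ht tk _]]]]]].
rewrite !mulN in et ht tk.
have et2 : emb t' = k *[b] emb t *[b] h by rewrite et mulA.
by split=> h1; [apply: le_move es et2 tk h1|apply: le_move et2 es gs h1].
Qed.

(** In the descending part the same argument runs from the left end: the first
    elements are representatives of one class, hence equal, so that the factor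
    that links them to the rest is trivial on all smaller elements. *)
Theorem shape_unique c g g' W W' : eqv c g g' W W' -> shape W -> shape W' ->
  (if W is Some (b, s) :: _ then g *[b] emb s = emb s else True) -> W = W'.
Proof.
elim: W W' c g g' => [|[[b s]|] V IH] W' c g g' //.
move=> e; have := e; move=> /eqv_inv[s' [h [h' [V' [EW' [_ es _ sh e']]]]]].
rewrite EW' in e * => sW sW' gs; rewrite gs in es.
suff [EV sh1] : V = V' /\ emb s *[b] h = emb s.
  by rewrite EV; congr (Some (_, _) :: _); apply: emb_inj; rewrite es sh1.
case: sW sW' => [hV|hV] [hV'|hV'].
- exact: valley_unique hV hV' e'.
- case: V V' hV hV' e {IH e' EW'} => [|[[d t]|] V] [|[[d' t']|] V'] //.
    by move=> _ _ /eqv_inv[? [? [? [? [[_ <-] [_ _ _ _ []]]]]]].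
  by move=> [-> lst _ _] [-> /ltE[_ n] _ _] /eqv_le_down[/(_ lst)].
- case: V V' hV hV' e {IH e' EW'} => [|[[d t]|] V] [|[[d' t']|] V'] //.
    by move=> _ _ /eqv_inv[? [? [? [? [[_ <-] [_ _ _ _ []]]]]]].
  move=> [-> /ltE[_ n] _ _] [-> lst _ _] /eqv_sym/eqv_le_down[/(_ lst)] //.
- case: V V' hV hV' e' {e EW'} IH => [|[[d t]|] V] [|[[d' t']|] V'] //.
  move=> [-> /ltE[lts _] rs hV] [-> _ rs' hV'] e' IH.
  have Es : s = s'.
    by apply: val_inj; rewrite rs rs'; apply: rep_unique; apply: equiv_move es sh.
  have sh1 : emb s *[b] h = emb s by rewrite -es Es.
  split=> //; apply: IH e' hV hV' _; rewrite mulN.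
  by have /lenzP[x ->] := lts; rewrite -mulA sh1.
Qed.

(** * Confluence *)

Definition rewrites_star : word -> word -> Prop := clos_refl_trans word rewrites.

Definition irreducible W := forall V, ~ rewrites W V.

Lemma irreducible_exists W : exists2 V, rewrites_star W V & irreducible V.
Proof.
elim: (rewrites_wf W) => {}W _ IH.
case: (pselect (irreducible W)) => [h|/existsNP[V /contrapT h]].
  by exists W => //; apply: rt_refl.
have [U h1 h2] := IH V h; exists U => //.
by apply: rt_trans (rt_step _ _ _ _ h) h1.
Qed.

Section Uniqueness.
Hypothesis unam : unambiguous S.

(** The [red]-normal form up to [sim] is an invariant of all rewrite steps. *)
Lemma rewrites_reduces_to W W' V V' : rewrites W W' ->
  reduces_to W V -> reduces_to W' V' -> sim V V'.
Proof.
move=> [h|h] hV hV'; last exact: reduced_form_unique (choose_sim h) hV hV'.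
apply: (reduced_form_unique unam (sim_refl W)) hV _.
by case: hV' => h1 h2; split=> //; apply: rt_trans (rt_step _ _ _ _ h) h1.
Qed.

Lemma rewrites_star_reduces_to W W' V V' : rewrites_star W W' ->
  reduces_to W V -> reduces_to W' V' -> sim V V'.
Proof.
move=> h; elim: h V V' => {W W'}.
- by move=> W W' h V V'; apply: rewrites_reduces_to.
- by move=> W V V'; apply: reduced_form_unique => //; apply: sim_refl.
- move=> W X Y _ IH1 _ IH2 V V' hV hV'.
  have [U hU] := reduces_to_exists X.
  exact: sim_trans (IH1 _ _ hV hU) (IH2 _ _ hU hV').
Qed.

(** The invariant identifies two irreducible strings up to moved factors, and
    the choice of representatives leaves no room for these. *)
Lemma irreducible_unique W N N' : rewrites_star W N -> rewrites_star W N' ->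
  irreducible N -> irreducible N' -> N = N'.
Proof.
move=> h h' irr irr'.
have red_irr U : irreducible U -> reduced U by move=> hU X hX; apply: (hU X); left.
have nf U : irreducible U -> reduces_to U U.
  by move=> /red_irr hU; split=> //; apply: rt_refl.
have [V hV] := reduces_to_exists W.
have s1 := rewrites_star_reduces_to h hV (nf _ irr).
have s2 := rewrites_star_reduces_to h' hV (nf _ irr').
case: (sim_trans (sim_sym s1) s2) => [[d d']|e].
  by rewrite (reduced_zero (red_irr _ irr) d) (reduced_zero (red_irr _ irr') d').
have /andP[lN lN'] := eqv_zero_free e.
case: N N' irr irr' e lN lN' {h h' s1 s2} => [|x N] [|x' N'] //.
  by case: x => [[]|].
move=> irr irr' e lN lN'; apply: (shape_unique e); [exact: irreducible_shape..|].
by case: x {irr e lN} => [[]|].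
Qed.

Lemma rewrites_confluent W X Y : rewrites_star W X -> rewrites_star W Y ->
  exists2 Z, rewrites_star X Z & rewrites_star Y Z.
Proof.
move=> hX hY.
have [N hN iN] := irreducible_exists X; have [N' hN' iN'] := irreducible_exists Y.
exists N => //; suff -> : N = N' by [].
apply: (@irreducible_unique W) => //; first exact: rt_trans hX hN.
exact: rt_trans hY hN'.
Qed.

End Uniqueness.

(** * The rewrite system on the original alphabet *)

Definition dec (x : letter S) : option (bool * nz) :=
  match x with
  | Zero => None
  | Plain s => Some (false, s)
  | Barred s => Some (true, s)
  end.

Definition enc (x : option (bool * nz)) : letter S :=
  match x with
  | None => Zero
  | Some (b, s) => if b then Barred s else Plain s
  end.

Lemma decK : cancel dec enc. Proof. by case. Qed.
Lemma encK : cancel enc dec. Proof. by case=> [[[] s]|]. Qed.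

Lemma dec_plain s : dec (plain s) = letter_of false s.
Proof. by rewrite /plain /letter_of; case: insub. Qed.

Lemma dec_barred s : dec (barred s) = letter_of true s.
Proof. by rewrite /barred /letter_of; case: insub. Qed.

Lemma enc_letter_of b s : enc (letter_of b s) = if b then barred s else plain s.
Proof. by case: b; rewrite -?dec_plain -?dec_barred decK. Qed.

Lemma red_letter_of_mul b s t q :
  red (letter_of b s :: letter_of b t :: q) (letter_of b (op b s t) :: q).
Proof.
case: (letter_ofP b s) => [s' <-|zs]; first exact: red_letter_of_mul_r.
by rewrite op_zero_l // !(letter_of_zero _ zs); apply: red_zl.
Qed.

Lemma SomeS1l x s : Some (mulS1l x s) = x *[false] Some s.
Proof. by case: x. Qed.

Lemma SomeS1r s x : Some (mulS1r s x) = x *[true] Some s.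
Proof. by case: x. Qed.

Lemma mul_true x y : x *[true] y = y *[false] x.
Proof. exact: (mulN false). Qed.

Lemma letter_of_nz b m (x : nz) : val x = m -> letter_of b m = Some (b, x).
Proof. by move=> <-; apply: letter_of_val. Qed.

Lemma graphBR_nz (s t : nz) m : graphBR r (val s) (val t) m ->
  exists x s' t', [/\ val s' = r (val s), val t' = m,
    emb t = x *[false] emb s & emb t' = x *[false] emb s'].
Proof.
move=> [_ [x [_ et ->]]]; exists x.
have ex : emb t = x *[false] emb s by rewrite -SomeS1l -et.
have [s' [t' [es' et']]] := rep_exists ex.
exists s', t'; split=> //; apply: Some_inj.
by rewrite SomeS1l -[r _]es'.
Qed.

Lemma graphBL_nz (s t : nz) m : graphBL ell (val t) (val s) m ->
  exists x s' t', [/\ val s' = ell (val s), val t' = m,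
    emb t = x *[true] emb s & emb t' = x *[true] emb s'].
Proof.
move=> [_ [x [_ et ->]]]; exists x.
have ex : emb t = x *[true] emb s by rewrite -SomeS1r -et.
have [s' [t' [es' et']]] := rep_exists ex.
exists s', t'; split=> //; apply: Some_inj.
by rewrite SomeS1r -[ell _]es'.
Qed.

Lemma rule_rewrites x y q : rule r ell x y ->
  rewrites (map dec x ++ q) (map dec y ++ q).
Proof.
case=> {x y} /=.
- by move=> s t; left; rewrite !dec_plain; apply: red_letter_of_mul.
- by move=> s t; left; rewrite !dec_barred; apply: red_letter_of_mul.
- by left; apply: red_zl.
- by move=> s; left; apply: red_zl.
- by move=> s; left; apply: red_zr.
- by move=> s; left; apply: red_zl.
- by move=> s; left; apply: red_zr.
- by move=> s t h; left; apply: red_inc => // /comparableE.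
- by move=> s t h; left; apply: red_inc => // /comparableE.
- move=> u v w m uv _ [_ _ [z [_ hw hm]]]; left; rewrite dec_plain.
  have [x hx] := proj1 (lenzP false u v) uv.
  apply: (red_meet (x := x) (z := z)) => //.
    by rewrite -mul_true -SomeS1r -hw.
  by rewrite -hx -mul_true hm SomeS1r.
- move=> u v w m uv wv [_ _ [z [_ hu hm]]]; left; rewrite dec_barred.
  have [x hx] := proj1 (lenzP false w v) wv.
  apply: (red_meet (x := z) (z := x)) => //.
  + by rewrite -SomeS1r -hu.
  + by rewrite -mulA [_ *[true] x]mul_true -hx hm SomeS1r.
- move=> s t m lts ns /graphBR_nz[x [s' [t' [es em et et']]]]; right.
  rewrite dec_plain dec_barred (letter_of_nz _ es) (letter_of_nz _ em).
  exact: (choose_down (b := false)) ns es et et'.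
- move=> s t m lts ns /graphBL_nz[x [s' [t' [es em et et']]]]; right.
  rewrite dec_plain dec_barred (letter_of_nz _ es) (letter_of_nz _ em).
  exact: (choose_down (b := true)) ns es et et'.
- move=> s t m lts ns /graphBL_nz[x [s' [t' [es em et et']]]]; right.
  rewrite dec_plain dec_barred (letter_of_nz _ es) (letter_of_nz _ em).
  exact: (choose_up (b := true)) ns es et et'.
- move=> s t m lts ns /graphBR_nz[x [s' [t' [es em et et']]]]; right.
  rewrite dec_plain dec_barred (letter_of_nz _ es) (letter_of_nz _ em).
  exact: (choose_up (b := false)) ns es et et'.
Qed.

Lemma rewrites_cons x W W' : rewrites W W' -> rewrites (x :: W) (x :: W').
Proof. by case=> h; [left; apply: red_cons|right; apply: choose_cons]. Qed.

Lemma step_rewrites w w' : step r ell w w' -> rewrites (map dec w) (map dec w').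
Proof.
move=> [p [q [x [y [h -> ->]]]]]; rewrite !map_cat.
elim: p => [|a p IH] /=; first exact: rule_rewrites.
exact: rewrites_cons.
Qed.

Lemma step_cons a w w' : step r ell w w' -> step r ell (a :: w) (a :: w').
Proof. by move=> [p [q [x [y [h -> ->]]]]]; exists (a :: p), q, x, y. Qed.

Lemma rule_step x y q : rule r ell x y -> step r ell (x ++ q) (y ++ q).
Proof. by move=> h; exists [::], q, x, y. Qed.

Lemma enc_val b s : enc (Some (b, s)) = if b then barred (val s) else plain (val s).
Proof. by rewrite -enc_letter_of letter_of_val. Qed.

Lemma plain_val (s : nz) : plain (val s) = Plain s.
Proof. by rewrite /plain valK. Qed.

Lemma barred_val (s : nz) : barred (val s) = Barred s.
Proof. by rewrite /barred valK. Qed.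

Lemma rule_zl a : rule r ell [:: Zero; a] [:: Zero].
Proof.
by case: a => [|s|s]; rewrite -?plain_val -?barred_val; constructor.
Qed.

Lemma rule_zr a : rule r ell [:: a; Zero] [:: Zero].
Proof.
by case: a => [|s|s]; rewrite -?plain_val -?barred_val; constructor.
Qed.

Lemma graphB_meet (u v w : nz) m x z :
  emb u = x *[false] emb v -> emb w = emb v *[false] z ->
  Some m = x *[false] emb v *[false] z -> graphB (val u) (val v) (val w) m.
Proof.
move=> hu hw hm; split.
- by apply/(lenzP false); exists x.
- by apply/(lenzP true); exists z; rewrite mul_true.
have [z1 h1 [h2 h3]] : exists2 y, S1 y &
    val w = mulS1r (val v) y /\ m = mulS1r (val u) y.
  apply: (S1_witness (x := z)).
    by move=> e he /= [-> ->]; have [_ ->] := he (val v); have [_ ->] := he (val u).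
  by split; apply: Some_inj; rewrite SomeS1r mul_true // hm -hu.
by exists z1.
Qed.

Lemma graphBR_move (s t s' t' : nz) x :
  emb t = x *[false] emb s -> val s' = r (val s) -> emb t' = x *[false] emb s' ->
  graphBR r (val s) (val t) (val t').
Proof.
move=> et es et'; split; first by apply/(lenzP false); exists x.
have [y h1 [h2 h3]] : exists2 y, S1 y &
    val t = mulS1l y (val s) /\ val t' = mulS1l y (r (val s)).
  apply: (S1_witness (x := x)).
    by move=> e he /= [-> ->]; have [-> _] := he (val s); have [-> _] := he (r (val s)).
  by rewrite -es; split; apply: Some_inj; rewrite SomeS1l.
by exists y.
Qed.

Lemma graphBL_move (s t s' t' : nz) x :
  emb t = x *[true] emb s -> val s' = ell (val s) -> emb t' = x *[true] emb s' ->
  graphBL ell (val t) (val s) (val t').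
Proof.
move=> et es et'; split; first by apply/(lenzP true); exists x.
have [y h1 [h2 h3]] : exists2 y, S1 y &
    val t = mulS1r (val s) y /\ val t' = mulS1r (ell (val s)) y.
  apply: (S1_witness (x := x)).
    by move=> e he /= [-> ->]; have [_ ->] := he (val s); have [_ ->] := he (ell (val s)).
  by rewrite -es; split; apply: Some_inj; rewrite SomeS1r.
by exists y.
Qed.

Lemma rewrites_step W W' : rewrites W W' -> step r ell (map enc W) (map enc W').
Proof.
case=> h; elim: h => {W W'}.
- move=> b s t q; rewrite [map _ _]/= [X in step _ _ _ X]/= enc_letter_of.
  rewrite -[if b then Barred s else _]/(enc (Some (b, s))).
  rewrite -[if b then Barred t else _]/(enc (Some (b, t))) !enc_val.
  by case: b; apply: (rule_step (x := [:: _; _]) (y := [:: _])); constructor.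
- move=> x q; apply: (rule_step (x := [:: _; _]) (y := [:: _])); exact: rule_zl.
- move=> x q; apply: (rule_step (x := [:: _; _]) (y := [:: _])); exact: rule_zr.
- move=> b c s t q -> nc; apply: (rule_step (x := [:: _; _]) (y := [:: _])).
  by case: b nc => nc; constructor=> /= h; apply: nc; apply/comparableE.
- move=> b c u v w x z m q -> hu hw hm.
  have uv : le b (val u) (val v) by apply/lenzP; exists x.
  have wv : le (~~ b) (val w) (val v) by apply/lenzP; exists z; rewrite mulN.
  rewrite [X in step _ _ _ X]/= enc_letter_of.
  apply: (rule_step (x := [:: _; _; _]) (y := [:: _])).
  case: b hu hw hm uv wv => hu hw hm uv wv; last first.
    by apply: rule15 => //; apply: graphB_meet hu hw hm.
  rewrite !mul_true in hu hw hm.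
  apply: rule16 => //; apply: graphB_meet hw hu _.
  by rewrite hm mulA.
- by move=> x W W' _; apply: step_cons.
- move=> b c s t s' t' x q -> lts ns es et et'.
  apply: (rule_step (x := [:: _; _]) (y := [:: _; _])).
  rewrite [enc (Some (b, s'))]enc_val [enc (Some (~~ b, t'))]enc_val es.
  case: b lts ns es et et' => lts ns es et et'.
    by apply: rule22 => //; apply: graphBL_move et es et'.
  by apply: rule21 => //; apply: graphBR_move et es et'.
- move=> b c s t s' t' x q -> lts ns es et et'.
  apply: (rule_step (x := [:: _; _]) (y := [:: _; _])).
  rewrite [enc (Some (b, s'))]enc_val [enc (Some (~~ b, t'))]enc_val es.
  case: b lts ns es et et' => lts ns es et et'.
    by apply: rule23 => //; apply: graphBL_move et es et'.
  by apply: rule24 => //; apply: graphBR_move et es et'.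
- by move=> x W W' _; apply: step_cons.
Qed.

Lemma stepE w w' : step r ell w w' <-> rewrites (map dec w) (map dec w').
Proof.
split; first exact: step_rewrites.
by move=> /rewrites_step; rewrite !(mapK decK).
Qed.

(** * Normal forms described by positions *)

Definition alternating (b : bool) (a : nat -> nz) (k : nat) : word :=
  mkseq (fun i => Some (b (+) odd i, a i)) k.

Lemma alternatingS b a k :
  alternating b a k.+1 = Some (b, a 0) :: alternating (~~ b) (fun i => a i.+1) k.
Proof.
rewrite /alternating /mkseq /= addbF; congr (_ :: _).
rewrite -[1]/(1 + 0)%N iotaDl -map_comp; apply: eq_map => i /=.
by rewrite add1n /= addbN addNb.
Qed.

Lemma upP b s a k : up b s (alternating (~~ b) a k) <->
  [/\ (0 < k)%N -> lt b (val s) (val (a 0)),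
      forall i, (i.+1 < k)%N -> lt (~~ b (+) odd i) (val (a i)) (val (a i.+1)) &
      forall i, (i < k)%N -> val (a i) = rep (b (+) odd i) (val (a i))].
Proof.
elim: k b s a => [|k IH] b s a; first by split.
rewrite alternatingS /=; split.
  move=> [_ lst e /IH[h1 h2 h3]]; split=> //.
    move=> [|i] hi; first by rewrite addbF; apply: h1.
    by rewrite addbN -addNb; apply: h2.
  move=> [|i] hi; first by rewrite addbF.
  by rewrite addbN -addNb; apply: h3.
move=> [h1 h2 h3]; split=> //; first exact: h1.
  by have := h3 0 isT; rewrite addbF.
apply/IH; split.
- by move=> k0; have := h2 0 k0; rewrite addbF.
- by move=> i hi; have := h2 i.+1 hi; rewrite addbN -addNb.
- by move=> i hi; have := h3 i.+1 hi; rewrite addbN -addNb.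
Qed.

Lemma shape_alternating W : shape W -> exists b a, W = alternating b a (size W).
Proof.
elim: W => [//|[[b s]|] // V IH] hW; exists b.
suff [a {1}->] : exists a, V = alternating (~~ b) a (size V).
  by exists (fun i => if i is j.+1 then a j else s); rewrite alternatingS.
case: V hW IH => [|[[c t]|] V] hW IH; first by exists (fun _ => s).
  have [d [a E]] := IH (shape_tail hW); exists a; rewrite {1}E.
  suff -> : d = ~~ b by [].
  have -> : d = c by move: E; rewrite [size _]/= alternatingS => -[].
  by case: hW => -[].
by case: hW.
Qed.

(** The position [c] of the valley is counted from 0. *)
Definition valley_at (b : bool) (a : nat -> nz) (k c : nat) : Prop :=
  [/\ forall i, (i < c)%N -> lt (b (+) odd i) (val (a i.+1)) (val (a i)),
      (c.+1 < k)%N -> le (b (+) odd c) (val (a c)) (val (a c.+1)),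
      forall i, (c < i)%N -> (i.+1 < k)%N ->
        lt (b (+) odd i) (val (a i)) (val (a i.+1)),
      forall i, (i < c)%N -> val (a i) = rep (b (+) odd i) (val (a i)) &
      forall i, (c < i)%N -> (i < k)%N ->
        val (a i) = rep (~~ (b (+) odd i)) (val (a i))].

Lemma valleyP b a k :
  valley b (a 0) (alternating (~~ b) (fun i => a i.+1) k) <-> valley_at b a k.+1 0.
Proof.
case: k => [|k].
  split=> //= _; split=> // -[|i] //.
rewrite alternatingS [valley _ _ _]/= ; split.
  move=> [_ h e /upP[h1 h2 h3]]; split=> //.
  - by rewrite addbF.
  - move=> [|[|i]] // _ hi; first by rewrite /= addbT; apply: h1.
    by have := h2 i hi; rewrite /= !negbK.
  - move=> [|[|i]] // _ hi; first by rewrite /= addbT negbK.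
    by have := h3 i hi; rewrite /= !negbK addNb.
move=> [_ h1 h2 _ h3]; split=> //.
- by have := h1 isT; rewrite addbF.
- by have := h3 1 isT isT; rewrite /= addbT negbK.
apply/upP; split.
- by move=> k0; have := h2 1 isT k0; rewrite /= addbT.
- by move=> i hi; have := h2 i.+2 isT hi; rewrite /= !negbK.
- by move=> i hi; have := h3 i.+2 isT hi; rewrite /= !negbK addNb.
Qed.

Lemma shapeP b a k : shape (alternating b a k) <->
  exists2 c, (c < k)%N & valley_at b a k c.
Proof.
elim: k b a => [|k IH] b a; first by split=> // -[].
have hv := valleyP b a k; have {IH} := IH (~~ b) (fun i => a i.+1).
rewrite alternatingS; case: k hv => [|k]; last rewrite alternatingS.
  move=> hv _; split; first by case=> // /hv h; exists 0.
  by move=> [[|c] //] _ /hv; left.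
move=> hv IH; split.
  case=> [/hv h|[_ h e /IH[c ck [h1 h2 h3 h4 h5]]]]; first by exists 0.
  exists c.+1 => //; split.
  - move=> [|i] hi; first by rewrite addbF.
    by have := h1 i hi; rewrite /= addbN addNb.
  - by move=> hc; have := h2 hc; rewrite /= addbN addNb.
  - by move=> [|i] // ci hi; have := h3 i ci hi; rewrite /= addbN addNb.
  - move=> [|i] hi; first by rewrite addbF.
    by have := h4 i hi; rewrite /= addbN addNb.
  - by move=> [|i] // ci hi; have := h5 i ci hi; rewrite /= addbN addNb.
case=> -[|c] ck; first by move=> /hv; left.
move=> [h1 h2 h3 h4 h5]; right; split=> //.
- by have := h1 0 isT; rewrite addbF.
- by have := h4 0 isT; rewrite addbF.
apply/IH; exists c => //; split.
- by move=> i hi; have := h1 i.+1 hi; rewrite /= addbN addNb.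
- by move=> hc; have := h2 hc; rewrite /= addbN addNb.
- by move=> i ci hi; have := h3 i.+1 ci hi; rewrite /= addbN addNb.
- by move=> i hi; have := h4 i.+1 hi; rewrite /= addbN addNb.
- by move=> i ci hi; have := h5 i.+1 ci hi; rewrite /= addbN addNb.
Qed.

Lemma repE b s : rep b s = if b then ell s else r s.
Proof. by case: b. Qed.

Lemma normal_shapeP w : normal_shape r ell w <-> shape (map dec w).
Proof.
have enc_alt b a k :
    map enc (alternating b a k)
    = mkseq (fun i => if b (+) odd i then Barred (a i) else Plain (a i)) k.
  by rewrite /alternating /mkseq -map_comp.
split.
  move=> [k [c [b [a [ck -> [h1 h2 h3] h4 h5]]]]].
  rewrite -enc_alt (mapK encK); apply/shapeP; exists c => //; split=> //.
    by move=> i hi; rewrite repE; apply: h4.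
  by move=> i ci hi; rewrite repE if_neg; apply: h5.
move=> hw; have [b [a E]] := shape_alternating hw.
move: hw; rewrite E => /shapeP[c ck [h1 h2 h3 h4 h5]].
exists (size (map dec w)), c, b, a; split=> //.
- by rewrite -enc_alt -E (mapK decK).
- by move=> i hi; rewrite -repE; apply: h4.
- by move=> i ci hi; have := h5 i ci hi; rewrite repE if_neg.
Qed.

Lemma normal_formE w : normal_form (step r ell) w <-> irreducible (map dec w).
Proof.
split=> h.
  move=> V hV; apply: h; exists (map enc V); apply/stepE.
  by rewrite (mapK encK).
by move=> [v /stepE]; apply: h.
Qed.

End Representatives.
End Theory.

Theorem theorem2p1 (S : semigroupType) (r ell : S -> S) :
  unambiguous S ->
  representatives r ell ->
  complete (step r ell) /\
  (forall w : seq (letter S), w <> [::] ->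
     (normal_form (step r ell) w <->
        w = [:: Zero] \/ normal_shape r ell w)).
Proof.
move=> unam hrep; split; first split.
- move=> [f hf].
  have: forall W n, W = map (@dec S) (f n) -> False.
    move=> W; elim: (rewrites_wf hrep W) => {}W _ IH n EW.
    apply: (IH (map (@dec S) (f n.+1)) _ n.+1) => //.
    by rewrite EW; apply: step_rewrites.
  by move/(_ _ 0 erefl).
- have stepsE x y : clos_refl_trans _ (step r ell) x y ->
      rewrites_star r ell (map (@dec S) x) (map (@dec S) y).
    elim=> [u v /step_rewrites h|u|u v t _ h1 _ h2]; first exact: rt_step (h hrep).
      exact: rt_refl.
    exact: rt_trans h1 h2.
  have stepsD X Y : rewrites_star r ell X Y ->
      clos_refl_trans _ (step r ell) (map (@enc S) X) (map (@enc S) Y).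
    elim=> [u v /rewrites_step h|u|u v t _ h1 _ h2]; first exact: rt_step.
      exact: rt_refl.
    exact: rt_trans h1 h2.
  move=> x y z /stepsE hxy /stepsE hxz.
  have [W /stepsD hy /stepsD hz] := rewrites_confluent hrep unam hxy hxz.
  by exists (map (@enc S) W); rewrite !(mapK (@decK S)) in hy hz.
move=> w w0; split.
  move=> /(normal_formE hrep) irr.
  case: (boolP (zero_free (map (@dec S) w))) => lw.
    right; apply/normal_shapeP; apply: (irreducible_shape hrep _ lw irr).
    by case: (w) w0.
  left; have E := reduced_zero (fun V h => irr V (or_introl h)) lw.
  by rewrite -[w](mapK (@decK S)) E.
case=> [->|/normal_shapeP hw]; apply/(normal_formE hrep).
  exact: irreducible_zero.
by move=> V; apply: shape_irreducible.
Qed.
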